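(* Let $V$ be the load variation obtained by the Model Predictive Deferrable Load Control algorithm (Algorithm 1) in the stochastic model described in the context. Suppose that a $t$-valley-filling solution exists for $t=1,2,\ldots,T$, and that prediction errors are bounded by $\epsilon_1$ and $\epsilon_2$, i.e. $|a(t)-\lambda|\le\epsilon_1$ and $|e(t)|\le\epsilon_2$ for all $t=1,\ldots,T$. Then for every real $t>0$, $$\mathbb{P}(V-\mathbb{E}V>t)\le\exp\left(\frac{-t^2}{16\,\epsilon^2\lambda_1(2\,\mathbb{E}V+t)}\right),$$ where $\epsilon=\max(\epsilon_1,\epsilon_2)$ and $$\lambda_1=\max\left(\frac{\ln T}{T},\ \frac{1}{T^2}\sum_{t=0}^{T-1}F^2(t)\,\frac{T-t+1}{t+1}\right).$$
   Context: Model. Fix a horizon $T\in\mathbb{Z}_{\ge1}$. Baseload: $b(\tau)=\bar b(\tau)+\sum_{m=1}^T e(m)f(\tau-m)$, $\tau=1,\ldots,T$, where $\bar b$ is deterministic, $e(1),\ldots,e(T)$ are independent real random variables with mean $0$ and variance $\sigma^2$, and $f:\mathbb{Z}\to\mathbb{R}$ is the impulse response of a causal filter ($f(\tau)=0$ for $\tau<0$). The prediction at time $t$ is $b_t(\tau)=\bar b(\tau)+\sum_{m=1}^t e(m)f(\tau-m)$. Set $F(t)=\sum_{m=0}^t f(m)$. Deferrable loads: devices $n=1,\ldots,N$ have power consumption $p_n(t)$ constrained by $\underline p_n(t)\le p_n(t)\le\overline p_n(t)$ and $\sum_{t=1}^T p_n(t)=P_n$, with both bounds equal to $0$ before arrival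 and after the deadline of device $n$. $N(t)$ is the number of devices that have arrived by time $t$ (devices are numbered by arrival, $N(0)=0$, $N(T)=N$). The energy request arriving at time $t$ is $a(t)=\sum_{n=N(t-1)+1}^{N(t)}P_n$; $a(1),\ldots,a(T)$ are independent random variables with mean $\lambda$ and variance $s^2$, and the families $(a(t))_t$ and $(e(t))_t$ are independent of each other. Let $A(t)=\sum_{\tau=t+1}^T a(\tau)$. Algorithm 1. Initialize $P_n(1)=P_n$. At each time $t=1,\ldots,T$, solve problem ODLC-$t$: minimize $\sum_{\tau=t}^T\bigl(\sum_{n=1}^{N(t)}p_n(\tau)+q(\tau)+b_t(\tau)\bigr)^2$ over $p_n(\tau),q(\tau)$ ($n\le N(t)$, $\tau\ge t$) subject to $\underline p_n(\tau)\le p_n(\tau)\le\overline p_n(\tau)$, $\sum_{\tau=t}^T p_n(\tau)=P_n(t)$, $\underline q(\tau)\le q(\tau)\le\overline q(\tau)$, $\sum_{\tau=t}^T q(\tau)=\mathbb{E}(A(t))$, where $\underline q,\overline q$ are given bounds with $\underline q(t)=\overline q(t)=0$. Implement only the time-$t$ values $p_n(t)$ of the solution for $n\le N(t)$, and update $P_n(t+1)=P_n(t)-p_n(t)$. A $t$-valley-filling solution is a feasible $(p,q)$ of ODLC-$t$ for which there is $C(t)\in\mathbb{R}$ with $\sum_{n=1}^{N(t)}p_n(\tau)+q(\tau)+b_t(\tau)=C(t)$ for all $\tau=t,\ldots,T$. If it exists, it solves ODLC-$t$, and the realized aggregate load $d(t)=b(t)+\sum_{n=1}^N p_n(t)$ is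 $$d(t)=\frac{1}{T-t+1}\left(\sum_{n=1}^{N(t)}P_n(t)+\mathbb{E}(A(t))+\sum_{\tau=t}^T b_t(\tau)\right).$$ The load variation is $V=\frac1T\sum_{t=1}^T\bigl(d(t)-\frac1T\sum_{\tau=1}^T d(\tau)\bigr)^2$, computed from the realized aggregate load $d$. *)

(* Defs.v *)
From HB Require Import structures.
From mathcomp Require Import all_boot all_order all_algebra.
From mathcomp Require Import all_classical all_reals all_analysis.

Set Implicit Arguments.
Unset Strict Implicit.
Unset Printing Implicit Defensive.

Import Order.TTheory GRing.Theory Num.Theory.
Import numFieldNormedType.Exports.
Local Open Scope classical_set_scope.
Local Open Scope ring_scope.

(* Times are natural numbers and the horizon is 1, ..., T; devices are numbered
   from 1.  Values of time- or device-indexed functions outside their ranges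
   are never constrained and play no role. *)

(* {1, ..., T} *)
Definition horizon (T : nat) : set nat := [set t | (1 <= t <= T)%N].

(* Mutual independence: the product rule over every finite subfamily. *)
Definition independent_RVs (R : realType) (d : measure_display)
    (Omega : measurableType d) (P : probability Omega R)
    (I : set nat) (X : nat -> {RV P >-> R}) : Prop :=
  forall (J : seq nat) (B : nat -> set R),
    uniq J -> [set` J] `<=` I -> (forall i, measurable (B i)) ->
    P (\bigcap_(i in [set` J]) (X i @^-1` B i)) =
    (\prod_(i <- J) P (X i @^-1` B i))%E.

Definition sigma_RVs (R : realType) (d : measure_display)
    (Omega : measurableType d) (P : probability Omega R)
    (I : set nat) (X : nat -> {RV P >-> R}) : set (set Omega) :=
  <<s [set A | exists2 i, I i &
               exists2 B : set R, measurable B & A = X i @^-1` B] >>.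

Definition independent_families (R : realType) (d : measure_display)
    (Omega : measurableType d) (P : probability Omega R)
    (I : set nat) (X Y : nat -> {RV P >-> R}) : Prop :=
  forall A B : set Omega, sigma_RVs I X A -> sigma_RVs I Y B ->
    P (A `&` B) = (P A * P B)%E.

Definition causal (R : realType) (f : int -> R) : Prop :=
  forall k : int, k < 0 -> f k = 0.

(* b_t(tau) *)
Definition predicted_baseload (R : realType) (bbar : nat -> R) (f : int -> R)
    (e : nat -> R) (t tau : nat) : R :=
  bbar tau + \sum_(1 <= m < t.+1) e m * f (tau%:Z - m%:Z).

(* b(tau); by definition it is the time-T prediction *)
Definition baseload (R : realType) (T : nat) (bbar : nat -> R) (f : int -> R)
    (e : nat -> R) (tau : nat) : R :=
  predicted_baseload bbar f e T tau.

(* F(t) *)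
Definition cumulative_response (R : realType) (f : int -> R) (t : nat) : R :=
  \sum_(0 <= m < t.+1) f m%:Z.

(* One realization of the deferrable loads. *)
Record deferrable_loads (R : realType) := DeferrableLoads {
  arrived : nat -> nat;            (* N(t) *)
  energy : nat -> R;               (* P_n *)
  deadline : nat -> nat;
  power_lo : nat -> nat -> R;      (* device n, time t *)
  power_hi : nat -> nat -> R }.

(* Devices are numbered by arrival, so device n has not arrived by time t
   exactly when N(t) < n; the total number of devices is N = N(T). *)
Definition valid_loads (R : realType) (T : nat) (L : deferrable_loads R)
    : Prop :=
  [/\ arrived L 0 = 0%N,
      forall t, (t < T)%N -> (arrived L t <= arrived L t.+1)%N &
      forall n t, (1 <= n <= arrived L T)%N -> (1 <= t <= T)%N ->
        (arrived L t < n)%N \/ (deadline L n < t)%N ->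
        power_lo L n t = 0 /\ power_hi L n t = 0].

(* a(t) *)
Definition energy_request (R : realType) (L : deferrable_loads R) (t : nat)
    : R :=
  \sum_((arrived L t.-1).+1 <= n < (arrived L t).+1) energy L n.

Section ODLC.
Variables (R : realType) (T : nat) (L : deferrable_loads R).
(* the current time t, the pseudo-load bounds used in ODLC-t, the expected
   future energy E(A(t)), the prediction b_t and the state n |-> P_n(t) *)
Variables (t : nat) (qlo qhi : nat -> R) (EA : R) (bt : nat -> R)
  (Pt : nat -> R).

Definition odlc_feasible (p : nat -> nat -> R) (q : nat -> R) : Prop :=
  [/\ forall n tau, (1 <= n <= arrived L t)%N -> (t <= tau <= T)%N ->
        power_lo L n tau <= p n tau <= power_hi L n tau,
      forall n, (1 <= n <= arrived L t)%N ->
        \sum_(t <= tau < T.+1) p n tau = Pt n,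
      forall tau, (t <= tau <= T)%N -> qlo tau <= q tau <= qhi tau &
      \sum_(t <= tau < T.+1) q tau = EA].

Definition planned_load (p : nat -> nat -> R) (q : nat -> R) (tau : nat) : R :=
  \sum_(1 <= n < (arrived L t).+1) p n tau + q tau + bt tau.

Definition odlc_cost (p : nat -> nat -> R) (q : nat -> R) : R :=
  \sum_(t <= tau < T.+1) planned_load p q tau ^+ 2.

Definition odlc_solution (p : nat -> nat -> R) (q : nat -> R) : Prop :=
  odlc_feasible p q /\
  forall p' q', odlc_feasible p' q' -> odlc_cost p q <= odlc_cost p' q'.

Definition valley_filling (p : nat -> nat -> R) (q : nat -> R) : Prop :=
  odlc_feasible p q /\
  exists C : R, forall tau, (t <= tau <= T)%N -> planned_load p q tau = C.

End ODLC.

(* (p, Prem) is a run of Model Predictive Deferrable Load Control on one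
   realization: p n t is the implemented power p_n(t) and Prem t n the state
   P_n(t).  ODLC-t may have several solutions; any choice is a run.  A device
   that has not arrived consumes nothing, so its state stays equal to P_n. *)
Definition mpc_run (R : realType) (T : nat) (L : deferrable_loads R)
    (qlo qhi : nat -> nat -> R) (EA : nat -> R) (b_ : nat -> nat -> R)
    (p : nat -> nat -> R) (Prem : nat -> nat -> R) : Prop :=
  [/\ forall n, (1 <= n <= arrived L T)%N -> Prem 1%N n = energy L n,
      forall t, (1 <= t <= T)%N ->
        exists pt qt,
          odlc_solution T L t (qlo t) (qhi t) (EA t) (b_ t) (Prem t) pt qt /\
          forall n, (1 <= n <= arrived L t)%N -> p n t = pt n t,
      forall n t, (1 <= t <= T)%N -> (arrived L t < n <= arrived L T)%N ->
        p n t = 0 &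
      forall n t, (1 <= t <= T)%N -> (1 <= n <= arrived L T)%N ->
        Prem t.+1 n = Prem t n - p n t].

(* d(t) *)
Definition aggregate_load (R : realType) (T : nat) (L : deferrable_loads R)
    (b : nat -> R) (p : nat -> nat -> R) (t : nat) : R :=
  b t + \sum_(1 <= n < (arrived L T).+1) p n t.

Definition load_variation (R : realType) (T : nat) (d : nat -> R) : R :=
  T%:R^-1 * \sum_(1 <= t < T.+1)
    (d t - T%:R^-1 * \sum_(1 <= tau < T.+1) d tau) ^+ 2.

Definition lambda1 (R : realType) (T : nat) (f : int -> R) : R :=
  Num.max (ln T%:R / T%:R)
    ((T%:R ^+ 2)^-1 * \sum_(0 <= t < T)
       cumulative_response f t ^+ 2 * ((T%:R - t%:R + 1) / (t%:R + 1))).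

(* Main.v *)
(* With u(tau) = a(tau) - lambda + e(tau) F(T - tau), flatness of every solution
   of ODLC-t gives d(t+1) = d(t) + u(t+1) / (T - t).  Hence V = |B X|^2 / T, where
   X collects the 2T independent centred variables a(tau) - lambda and e(tau)
   divided by eps, and the squared Hilbert-Schmidt norm of B is at most
   2 eps^2 T lambda1: the a-columns and the e-columns each contribute at most
   eps^2 T lambda1.

   The tail bound comes from an infimal-convolution inequality for quadratic
   forms: if S bounds |B|^2, then for th >= 0
     E exp (th / (1 + 4 th S) |B X|^2) <= exp (th E |B X|^2).
   Indeed th / (1 + 4 th S) |B x|^2 <= th |B y|^2 + |x - y|^2 / 4 for all y.
   Choosing y_k greedily from x_0, ..., x_k turns the right-hand side, with the
   coordinates not yet revealed replaced by their means, into the logarithm of a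
   supermartingale.  One step is the inequality
     E exp (s X^2 + b X) <= exp (A + b^2)
   for centred X in [-1, 1], with s = r / (1 + 4 r) and A = r E X^2.  Chernoff's
   bound concludes. *)

Require Import Defs.
From HB Require Import structures.
From mathcomp Require Import all_boot all_order all_algebra.
From mathcomp Require Import all_classical all_reals all_analysis.
From mathcomp Require Import measurable_realfun ring lra.

Set Implicit Arguments.
Unset Strict Implicit.
Unset Printing Implicit Defensive.

Import Order.TTheory GRing.Theory Num.Theory.
Import numFieldNormedType.Exports.
Local Open Scope classical_set_scope.
Local Open Scope ring_scope.

(** * Exponential inequalities *)

Section ExponentialBounds.
Variable R : realType.
Implicit Types b s x z : R.

Let chR z : R := (expR z + expR (- z)) / 2.
Let shR z : R := (expR z - expR (- z)) / 2.

Lemma nonneg_from_derive (f f' : R -> R) :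
  (forall x, is_derive x 1 f (f' x)) -> (forall x, 0 <= x -> 0 <= f' x) ->
  0 <= f 0 -> forall x, 0 <= x -> 0 <= f x.
Proof.
move=> df f'0 f0 x x0; apply: (le_trans f0).
apply: (@ger0_derive1_ndecry R f 0) => //.
- move=> y; rewrite in_itv/= andbT => /ltW y0.
  by rewrite derive1E (@derive_val _ _ _ _ _ _ _ (df y)); exact: f'0.
- apply: continuous_subspaceT => y; apply: differentiable_continuous.
  by apply/derivable1_diffP; have := df y; case.
Qed.

(** On x >= 0, 1 - cosh x exp (- x^2 / 2) vanishes at 0 and its derivative has the sign of x cosh x
    - sinh x, which also vanishes at 0 and has derivative x sinh x >= 0. *)
Lemma cosh_le_expR_sqr z : (expR z + expR (- z)) / 2 <= expR (z ^+ 2 / 2).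
Proof.
wlog z0 : z / 0 <= z.
  move=> H; have [z0|z0] := leP 0 z; first exact: H.
  by have := H (- z); rewrite opprK sqrrN addrC; apply; lra.
have sh0 x : 0 <= x -> 0 <= shR x.
  by move=> x0; rewrite /shR divr_ge0// subr_ge0 ler_expR; lra.
have tanh0 x : 0 <= x -> 0 <= x * chR x - shR x.
  move: x; apply: (@nonneg_from_derive (fun x => x * chR x - shR x)
    (fun x => x * shR x)).
  - move=> x; rewrite /chR /shR.
    by apply: is_derive_eq; rewrite /GRing.scale/=; field.
  - by move=> x x0; rewrite mulr_ge0// sh0.
  - by rewrite /shR mul0r oppr0 subrr mul0r subrr.
suff : 0 <= 1 - chR z * expR (- (z ^+ 2 / 2)).
  by rewrite subr_ge0 expRN ler_pdivrMr ?expR_gt0// mul1r.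
move: z z0; apply: (@nonneg_from_derive
  (fun x => 1 - chR x * expR (- (x ^+ 2 / 2)))
  (fun x => (x * chR x - shR x) * expR (- (x ^+ 2 / 2)))).
- move=> x; rewrite /chR /shR.
  by apply: is_derive_eq; rewrite /GRing.scale/=; field.
- by move=> x x0; rewrite mulr_ge0 ?expR_ge0// tanh0.
- by rewrite /chR oppr0 expr0n/= mul0r oppr0 expR0; lra.
Qed.

Lemma expR_chord (c d u : R) : 0 <= u <= 1 ->
  expR (u * c + (1 - u) * d) <= u * expR c + (1 - u) * expR d.
Proof.
move=> /andP[u0 u1]; set m := u * c + (1 - u) * d.
(* Tangent line at the mean point [m]: averaging the bounds at [c] and [d] cancels the slope. *)
have tangent y : expR m * (1 + (y - m)) <= expR y.
  rewrite -[leRHS]mulr1 -[X in _ <= _ * X](expRxMexpNx_1 m) mulrCA ler_wpM2l ?expR_ge0//.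
  by rewrite -expRD; exact: expR_ge1Dx.
apply: (@le_trans _ _ (u * (expR m * (1 + (c - m))) +
                       (1 - u) * (expR m * (1 + (d - m))))); last first.
  by rewrite lerD// ler_wpM2l// subr_ge0.
by rewrite le_eqVlt; apply/orP; left; apply/eqP; rewrite /m; ring.
Qed.

(* Coefficients of a quadratic majorant on [-1, 1] of [x |-> expR (s x^2 + b x)]:
   AM-GM with weight [w] separates the two terms, and each exponential is then
   bounded by a chord. *)
Definition maj0 (w b : R) : R :=
  (w + (expR (2 * b) + expR (- (2 * b))) / 2 / w) / 2.
Definition maj1 (w b : R) : R :=
  (expR (2 * b) - expR (- (2 * b))) / 2 / w / 2.
Definition maj2 (w s : R) : R := w * (expR (2 * s) - 1) / 2.

Lemma expR_quad_le_maj (w b s x : R) : 0 < w -> 0 <= s -> `|x| <= 1 ->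
  expR (s * x ^+ 2 + b * x) <= maj0 w b + maj1 w b * x + maj2 w s * x ^+ 2.
Proof.
move=> w0 s0; rewrite ler_norml => /andP[x1 x2].
have x01 : 0 <= x ^+ 2 <= 1 by apply/andP; split; nra.
(* AM-GM squares the two factors, hence the doubled exponents. The first is bounded by its chord in
   x^2 over [0, 1], the second by its chord in x over [-1, 1]. *)
have sq : expR (s * x ^+ 2 * 2) <= 1 + x ^+ 2 * (expR (2 * s) - 1).
  have := expR_chord (2 * s) 0 x01.
  rewrite mulr0 addr0 expR0 (_ : x ^+ 2 * (2 * s) = s * x ^+ 2 * 2); first lra.
  by ring.
have lin : expR (b * x * 2) <= (expR (2 * b) + expR (- (2 * b))) / 2
    + x * ((expR (2 * b) - expR (- (2 * b))) / 2).
  have u01 : 0 <= (1 + x) / 2 <= 1 by apply/andP; split; lra.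
  have := expR_chord (2 * b) (- (2 * b)) u01.
  rewrite (_ : _ * (2 * b) + _ = b * x * 2); last by field.
  by move/le_trans; apply; lra.
have am (p q : R) : p * q <= (w * p ^+ 2 + q ^+ 2 / w) / 2.
  rewrite -subr_ge0 (_ : _ - _ = (w * p - q) ^+ 2 / (2 * w)); last first.
    by field; rewrite gt_eqF.
  by rewrite divr_ge0 ?sqr_ge0// mulr_ge0// ltW.
rewrite expRD; apply: le_trans (am _ _) _.
rewrite -!expRM_natr.
have w1 : w * expR (s * x ^+ 2 * 2) <= w * (1 + x ^+ 2 * (expR (2 * s) - 1)).
  by rewrite ler_wpM2l// ltW.
have := ler_wpM2r (_ : 0 <= w^-1) lin; rewrite invr_ge0 => /(_ (ltW w0)).
by rewrite /maj0 /maj1 /maj2; nra.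
Qed.

(** Here [v] stands for E X^2, and [maj1] is absent because it multiplies a centred variable. The
    weight balances the two halves of the majorant: w exp (2 A) and exp (2 b^2) / w both equal exp
    (A + b^2). *)
Lemma maj_moment_le (A b s v : R) : v * (expR (2 * s) - 1) <= 2 * A ->
  maj0 (expR (b ^+ 2 - A)) b + maj2 (expR (b ^+ 2 - A)) s * v <=
  expR (A + b ^+ 2).
Proof.
move=> vA; set w := expR (b ^+ 2 - A).
have w0 : 0 < w by exact: expR_gt0.
have h1 : w * (1 + v * (expR (2 * s) - 1)) <= expR (A + b ^+ 2).
  apply: (@le_trans _ _ (w * expR (2 * A))).
    rewrite ler_wpM2l ?expR_ge0//; apply: le_trans (expR_ge1Dx _).
    by rewrite lerD2l.
  by rewrite -expRD le_eqVlt; apply/orP; left; apply/eqP; congr expR; ring.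
have h2 : (expR (2 * b) + expR (- (2 * b))) / 2 / w <= expR (A + b ^+ 2).
  apply: (@le_trans _ _ (expR ((2 * b) ^+ 2 / 2) / w)).
    by rewrite ler_wpM2r ?invr_ge0 ?expR_ge0// cosh_le_expR_sqr.
  rewrite /w -expRN -expRD le_eqVlt; apply/orP; left; apply/eqP.
  by congr expR; field.
by rewrite /maj0 /maj2; lra.
Qed.

(** From exp y <= 1 / (1 - y) at y = 2 s, where 1 / (1 - 2 s) = (1 + 4 th) / (1 + 2 th), and (1 + 2
    th)^2 >= 1 + 4 th. It supplies the hypothesis of [maj_moment_le]. *)
Lemma expR_double_le (th : R) : 0 <= th ->
  expR (2 * (th / (1 + 4 * th))) - 1 <= 2 * th.
Proof.
move=> th0; set s := th / _.
have d0 : 1 + 4 * th != 0 by rewrite gt_eqF//; lra.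
have d1 : 1 + 2 * th != 0 by rewrite gt_eqF//; lra.
have e1 : 1 - 2 * s = (1 + 2 * th) / (1 + 4 * th) by rewrite /s; field.
have e2 : 0 < 1 - 2 * s by rewrite e1 divr_gt0//; lra.
have : expR (2 * s) <= (1 - 2 * s)^-1.
  rewrite -[expR _]invrK -expRN lef_pV2 ?posrE ?expR_gt0//.
  exact: expR_ge1Dx.
rewrite e1 invf_div -/s => h.
have : (1 + 4 * th) / (1 + 2 * th) <= 1 + 2 * th.
  by rewrite ler_pdivrMr; [nra|lra].
by lra.
Qed.

End ExponentialBounds.

(** * Bounded random variables *)

Section BoundedFunctions.
Context {R : realType}.

(** The measurable structure is a parameter, so that the closure lemmas below also serve for the
    sigma-algebra of the variables already revealed, where measurability means dependence on the
    past. *)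
Definition bounded_mfun d (T : measurableType d) (g : T -> R) : Prop :=
  measurable_fun [set: T] g /\ exists M : R, forall w, `|g w| <= M.

Section Closure.
Context d (T : measurableType d).
Implicit Types g h : T -> R.

Lemma bounded_mfun_cst (r : R) : bounded_mfun (fun _ : T => r).
Proof. by split; [exact: measurable_cst|exists `|r|]. Qed.

Lemma bounded_mfunD g h : bounded_mfun g -> bounded_mfun h ->
  bounded_mfun (fun w => g w + h w).
Proof.
move=> [mg [M gM]] [mh [N hN]]; split; first exact: measurable_funD.
by exists (M + N) => w; rewrite (le_trans (ler_normD _ _))// lerD.
Qed.

Lemma bounded_mfunM g h : bounded_mfun g -> bounded_mfun h ->
  bounded_mfun (fun w => g w * h w).
Proof.
move=> [mg [M gM]] [mh [N hN]]; split; first exact: measurable_funM.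
by exists (M * N) => w; rewrite normrM ler_pM.
Qed.

Lemma bounded_mfunN g : bounded_mfun g -> bounded_mfun (fun w => - g w).
Proof.
move=> bg; rewrite (_ : (fun w => _) = (fun w => -1 * g w)).
  by apply: bounded_mfunM => //; exact: bounded_mfun_cst.
by apply/funext => w; rewrite mulN1r.
Qed.

Lemma bounded_mfunB g h : bounded_mfun g -> bounded_mfun h ->
  bounded_mfun (fun w => g w - h w).
Proof. by move=> bg bh; apply: bounded_mfunD => //; exact: bounded_mfunN. Qed.

Lemma bounded_mfunX g n : bounded_mfun g -> bounded_mfun (fun w => g w ^+ n).
Proof.
move=> bg; elim: n => [|n IHn].
  by under eq_fun do rewrite expr0; exact: bounded_mfun_cst.
by under eq_fun do rewrite exprS; exact: bounded_mfunM.
Qed.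

Lemma bounded_mfun_sum I (r : seq I) (g : I -> T -> R) :
  (forall i, bounded_mfun (g i)) ->
  bounded_mfun (fun w => \sum_(i <- r) g i w).
Proof.
move=> bg; elim: r => [|i r IHr].
  by under eq_fun do rewrite big_nil; exact: bounded_mfun_cst.
by under eq_fun do rewrite big_cons; exact: bounded_mfunD.
Qed.

Lemma bounded_mfun_expR g : bounded_mfun g ->
  bounded_mfun (fun w => expR (g w)).
Proof.
move=> [mg [M gM]]; split; first exact: measurableT_comp.
exists (expR M) => w; rewrite ger0_norm ?expR_ge0// ler_expR.
by rewrite (le_trans (ler_norm _)).
Qed.

End Closure.

Section Expectation.
Context d (T : measurableType d) (P : probability T R).
Implicit Types g h : T -> R.

Lemma bounded_mfun_integrable g : bounded_mfun g ->
  P.-integrable [set: T] (EFin \o g).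
Proof.
move=> [mg [M gM]]; apply: measurable_bounded_integrable => //.
  by rewrite (le_lt_trans (probability_le1 _ _))// ltry.
exists M; split; first exact: num_real.
by move=> x Mx w _ /=; rewrite (le_trans (gM w))// ltW.
Qed.

Definition mean g : R := fine ('E_P[g])%E.

Lemma meanE g : mean g = \int[P]_w g w.
Proof. by rewrite /mean unlock. Qed.

Lemma mean_EFin g : bounded_mfun g -> 'E_P[g]%E = (mean g)%:E.
Proof.
move=> /bounded_mfun_integrable gi; rewrite /mean fineK//.
by rewrite unlock integrable_fin_num.
Qed.

Lemma eq_mean g h : g =1 h -> mean g = mean h.
Proof. by move=> /funext ->. Qed.

Lemma mean_cst (r : R) : mean (fun _ => r) = r.
Proof. by rewrite /mean (expectation_cst P r). Qed.

Lemma meanD g h : bounded_mfun g -> bounded_mfun h ->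
  mean (fun w => g w + h w) = mean g + mean h.
Proof.
move=> /bounded_mfun_integrable gi /bounded_mfun_integrable hi.
by rewrite !meanE RintegralD.
Qed.

Lemma meanZ (r : R) g : bounded_mfun g -> mean (fun w => r * g w) = r * mean g.
Proof. by move=> /bounded_mfun_integrable gi; rewrite !meanE RintegralZl. Qed.

Lemma mean_sum I (r : seq I) (g : I -> T -> R) :
  (forall i, bounded_mfun (g i)) ->
  mean (fun w => \sum_(i <- r) g i w) = \sum_(i <- r) mean (g i).
Proof.
move=> bg; elim: r => [|i r IHr].
  by rewrite big_nil -[RHS](mean_cst 0); apply: eq_mean => w; rewrite big_nil.
rewrite big_cons -IHr -meanD//; last exact: bounded_mfun_sum.
by apply: eq_mean => w; rewrite big_cons.
Qed.

Lemma le_mean g h : bounded_mfun g -> bounded_mfun h ->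
  (forall w, g w <= h w) -> mean g <= mean h.
Proof.
move=> /bounded_mfun_integrable gi /bounded_mfun_integrable hi gh.
by rewrite !meanE le_Rintegral.
Qed.

Lemma mean_ge0 g : (forall w, 0 <= g w) -> 0 <= mean g.
Proof. by move=> g0; rewrite /mean fine_ge0// expectation_ge0. Qed.

(** The law of the pair agrees with the product of the marginal laws on rectangles, hence
    everywhere; Fubini then splits the integral of the product. *)
Lemma meanM_indep g h : bounded_mfun g -> bounded_mfun h ->
  (forall A B, measurable A -> measurable B ->
     P (g @^-1` A `&` h @^-1` B) = (P (g @^-1` A) * P (h @^-1` B))%E) ->
  mean (fun w => g w * h w) = mean g * mean h.
Proof.
move=> bg bh indep.
have [mg _] := bg; have [mh _] := bh.
pose gR : {mfun T >-> R} := HB.pack g (isMeasurableFun.Build _ _ _ _ g mg).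
pose hR : {mfun T >-> R} := HB.pack h (isMeasurableFun.Build _ _ _ _ h mh).
pose m1 := distribution P gR; pose m2 := distribution P hR.
pose phi w := (g w, h w).
have mphi : measurable_fun [set: T] phi by exact/measurable_fun_pairP.
pose phiR : {mfun T >-> (R * R)%type} :=
  HB.pack phi (isMeasurableFun.Build _ _ _ _ phi mphi).
pose mu := distribution P phiR.
have muE A : measurable A -> (m1 \x m2)%E A = mu A.
  by apply: product_measure_unique => B C mB mC; rewrite -indep.
pose f (z : R * R) := (z.1 * z.2)%:E.
have mf : measurable_fun [set: R * R] f.
  by apply/measurable_EFinP; apply: measurable_funM.
have fphi : P.-integrable [set: T] (f \o phi).
  exact: (bounded_mfun_integrable (bounded_mfunM bg bh)).
have imu : mu.-integrable [set: R * R] f by exact: integrable_pushforward.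
have im : (m1 \x m2)%E.-integrable [set: R * R] f.
  apply/integrableP; split=> //.
  rewrite (eq_measure_integral mu); first by case/integrableP : imu.
  by move=> A mA _; exact: muE.
have gh : (\int[P]_w (g w * h w)%:E = \int[m1 \x m2]_z f z)%E.
  rewrite [RHS](eq_measure_integral mu); last by move=> A mA _; exact: muE.
  by rewrite integral_distribution.
have i2 : m2.-integrable [set: R] EFin.
  by apply: integrable_pushforward => //; exact: (bounded_mfun_integrable bh).
have i1 : m1.-integrable [set: R] EFin.
  by apply: integrable_pushforward => //; exact: (bounded_mfun_integrable bg).
have E1 : (\int[m1]_x x%:E = (mean g)%:E)%E.
  rewrite -mean_EFin// unlock integral_distribution//.
  exact: (bounded_mfun_integrable bg).
have E2 : (\int[m2]_x x%:E = (mean h)%:E)%E.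
  rewrite -mean_EFin// unlock integral_distribution//.
  exact: (bounded_mfun_integrable bh).
rewrite {1}/mean unlock gh -integral12_prod_meas1// /fubini_F /f/=.
under eq_integral => x _.
  rewrite (_ : (\int[_]_y _)%E = x%:E * (mean h)%:E)%E; first over.
  by rewrite -E2 -integralZl//; apply: eq_integral => y _; rewrite EFinM.
by rewrite integralZr// E1.
Qed.

End Expectation.
End BoundedFunctions.

(** * Tail bound for quadratic forms *)

Section QuadraticPotential.
Variables (R : realType) (I : finType) (B : nat -> I -> R) (th : R).
Implicit Types (x : nat -> R) (k : nat).

Let sq k : R := \sum_i B k i ^+ 2.

(** AM-GM as a discriminant test, (a + c)^2 >= 4 a c, which avoids square roots. *)
Lemma le_add_of_sqr (a c u : R) : 0 <= a -> 0 <= c -> u ^+ 2 <= 4 * a * c ->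
  u <= a + c.
Proof.
move=> a0 c0 uac; have ac0 : 0 <= a + c by rewrite addr_ge0.
rewrite leNgt; apply/negP => acu.
have : (a + c) ^+ 2 < u ^+ 2 by rewrite ltr_pXn2r// nnegrE// ltW// (le_lt_trans ac0).
by have := sqr_ge0 (a - c); lra.
Qed.

Lemma cauchy_schwarz_sum J (r : seq J) (a b : J -> R) :
  (\sum_(j <- r) a j * b j) ^+ 2 <=
  (\sum_(j <- r) a j ^+ 2) * (\sum_(j <- r) b j ^+ 2).
Proof.
have sum_sqr_ge0 (c : J -> R) s : 0 <= \sum_(j <- s) c j ^+ 2.
  by apply: sumr_ge0 => j _; exact: sqr_ge0.
elim: r => [|j r IHr]; first by rewrite !big_nil mul0r expr0n.
rewrite !big_cons.
have := sum_sqr_ge0 a r; have := sum_sqr_ge0 b r; move: IHr.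
move: (\sum_(_ <- _) _ * _) (\sum_(_ <- _) a _ ^+ 2) (\sum_(_ <- _) b _ ^+ 2).
move=> C A D CAD D0 A0.
(* The cross term of the expanded product; the induction hypothesis bounds its square. *)
have : 2 * (a j * b j) * C <= A * b j ^+ 2 + D * a j ^+ 2.
  apply: le_add_of_sqr; [by rewrite mulr_ge0// sqr_ge0..|].
  have := ler_wpM2l (sqr_ge0 (a j * b j)) CAD.
  by move=> h; lra.
by move=> h; lra.
Qed.

(* For a prefix with centre [c = sum_(j < k) y_j B_j], the value of [y_k]
   minimizing [th |c + y B_k|^2 + (x_k - y)^2 / 4]. *)
Definition infconv_arg (c : I -> R) k (xk : R) : R :=
  (xk - 4 * th * \sum_i c i * B k i) / (1 + 4 * th * \sum_i B k i ^+ 2).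

Fixpoint infconv_center k x : I -> R :=
  if k is j.+1 then
    fun i => infconv_center j x i +
             infconv_arg (infconv_center j x) j (x j) * B j i
  else fun=> 0.

Definition infconv_cost k x : R :=
  \sum_(j < k) (x j - infconv_arg (infconv_center j x) j (x j)) ^+ 2 / 4.

(** The value at the greedy [y] of the objective of the infimal convolution, restricted to the first
    [k] coordinates: th |y_0 B_0 + ... + y_(k-1) B_(k-1)|^2 plus a quarter of the squared distance
    from x to y. *)
Definition potential k x : R :=
  th * (\sum_i infconv_center k x i ^+ 2) + infconv_cost k x.

(** The coefficient of [x k] in the increment of [potential]; it depends on earlier coordinates
    only. *)
Definition potential_slope k x : R :=
  2 * th * (\sum_i infconv_center k x i * B k i) / (1 + 4 * (th * sq k)).

Hypothesis th_ge0 : 0 <= th.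

Let sq_ge0 k : 0 <= sq k.
Proof. by apply: sumr_ge0 => i _; exact: sqr_ge0. Qed.

Let thsq_ge0 k : 0 <= th * sq k.
Proof. by rewrite mulr_ge0. Qed.

(** Minimizing over y_k by completing the square leaves a quadratic polynomial in [x k]. Its
    negative constant term later absorbs the squared slope produced by the moment bound. *)
Lemma potentialS k x : potential k.+1 x = potential k x
  - (1 + 4 * (th * sq k)) * potential_slope k x ^+ 2
  + (th * sq k / (1 + 4 * (th * sq k)) * x k ^+ 2 + potential_slope k x * x k).
Proof.
rewrite /potential /infconv_cost big_ord_recr/=.
rewrite [X in th * X + _](_ : _ = \sum_i infconv_center k x i ^+ 2
  + 2 * infconv_arg (infconv_center k x) k (x k) *
    (\sum_i infconv_center k x i * B k i)
  + infconv_arg (infconv_center k x) k (x k) ^+ 2 * sq k); last first.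
  rewrite /sq !mulr_sumr -!big_split/=; apply: eq_bigr => i _; ring.
rewrite /potential_slope /infconv_arg -/(sq k).
have : 1 + 4 * (th * sq k) != 0 by rewrite gt_eqF//; have := thsq_ge0 k; lra.
by move=> d0; field.
Qed.

(** Split x as y + (x - y). Cauchy-Schwarz bounds the form at x - y by 4 S times the cost, and the
    cross term is shared between the two parts of the potential. *)
Lemma potential_ge n x :
  th / (1 + 4 * th * \sum_(k < n) sq k) *
    (\sum_i (\sum_(k < n) x k * B k i) ^+ 2) <= potential n x.
Proof.
set S := \sum_(k < n) sq k.
have S0 : 0 <= S by apply: sumr_ge0 => k _.
pose y k := infconv_arg (infconv_center k x) k (x k).
have centerE m i : infconv_center m x i = \sum_(k < m) y k * B k i.
  by elim: m => [|m IHm]; rewrite ?big_ord0// big_ord_recr/= IHm.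
pose p i := infconv_center n x i.
pose D i := \sum_(k < n) (x k - y k) * B k i.
have xE i : \sum_(k < n) x k * B k i = p i + D i.
  rewrite /p centerE /D -big_split/=; apply: eq_bigr => k _; ring.
have cost0 : 0 <= infconv_cost n x.
  by apply: sumr_ge0 => k _; rewrite divr_ge0// sqr_ge0.
have DS : \sum_i D i ^+ 2 <= 4 * infconv_cost n x * S.
  have -> : 4 * infconv_cost n x = \sum_(k < n) (x k - y k) ^+ 2.
    by rewrite /infconv_cost -mulr_suml; field.
  rewrite /S /sq exchange_big mulr_sumr; apply: ler_sum => i _.
  exact: (cauchy_schwarz_sum _ (fun k : 'I_n => x k - y k)).
under eq_bigr do rewrite xE.
have -> : \sum_i (p i + D i) ^+ 2 =
    \sum_i p i ^+ 2 + 2 * (\sum_i p i * D i) + \sum_i D i ^+ 2.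
  rewrite mulr_sumr -!big_split/=; apply: eq_bigr => i _; ring.
have := cauchy_schwarz_sum (index_enum I) p D.
have : 0 <= \sum_i p i ^+ 2 by apply: sumr_ge0 => i _; exact: sqr_ge0.
rewrite /potential -/p; move: cost0 DS.
move: (\sum_i p i ^+ 2) (\sum_i p i * D i) (\sum_i D i ^+ 2) (infconv_cost n x).
move=> pp pD DD cost cost0 DS pp0 cs.
have thS : 0 <= th * S by rewrite mulr_ge0.
rewrite mulrAC ler_pdivrMr; last by nra.
(* The split is dictated by the target (th pp + cost) (1 + 4 th S): the summands th pp and 4 th S
   cost are taken by the two squares, and exactly the other two remain. *)
have : 2 * th * pD <= 4 * th ^+ 2 * S * pp + cost.
  apply: le_add_of_sqr => //; first by rewrite !mulr_ge0 ?sqr_ge0.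
  have : pD ^+ 2 <= pp * (4 * cost * S) by rewrite (le_trans cs)// ler_wpM2l.
  by move=> /(ler_wpM2l (sqr_ge0 (2 * th))); lra.
by have := ler_wpM2l th_ge0 DS; lra.
Qed.

End QuadraticPotential.

(** * Exponential moments and tails for independent bounded centred variables *)

Section IndependentBounded.
Context {R : realType} d {T : measurableType d} (P : probability T R).
Variables (n : nat) (X : nat -> T -> R).
Hypothesis X_measurable : forall k, measurable_fun [set: T] (X k).
Hypothesis X_le1 : forall k w, `|X k w| <= 1.
Hypothesis X_mean : forall k, (k < n)%N -> mean P (X k) = 0.
Hypothesis X_indep : forall k (B : nat -> set R), (k <= n)%N ->
  (forall i, measurable (B i)) ->
  P (\bigcap_(i in `I_k) (X i @^-1` B i)) = (\prod_(i < k) P (X i @^-1` B i))%E.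

(** A pi-system generating the sigma-algebra of the first [k] variables, made of the very events to
    which [X_indep] applies. *)
Definition past k : set (set T) :=
  [set A | exists2 B : nat -> set R, (forall i, measurable (B i)) &
    A = \bigcap_(i in `I_k) (X i @^-1` B i)].

Let X_preimage k (B : set R) : measurable B -> measurable (X k @^-1` B).
Proof. by move=> mB; rewrite -[_ @^-1` _]setTI; exact: X_measurable. Qed.

Lemma past_measurable k : past k `<=` measurable.
Proof.
by move=> _ [B mB ->]; apply: bigcap_measurableType => i _; exact: X_preimage.
Qed.

Lemma past_setI k : setI_closed (past k).
Proof.
move=> _ _ [B mB ->] [C mC ->]; exists (fun i => B i `&` C i).
  by move=> i; exact: measurableI.
by rewrite -bigcapI.
Qed.

(** As functions of [A], both sides are finite measures that agree on the pi-system [past k], hence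
    on the sigma-algebra it generates. *)
Lemma past_indep k (A : set T) (B : set R) : (k < n)%N -> <<s past k >> A ->
  measurable B -> P (A `&` X k @^-1` B) = (P A * P (X k @^-1` B))%E.
Proof.
move=> kn sA mB; have mXB := X_preimage k mB.
pose r : {nonneg R} := NngNum (fine_ge0 (measure_ge0 P (X k @^-1` B))).
have rE : (r%:num)%:E = P (X k @^-1` B).
  by rewrite fineK// fin_num_measure.
have setT_past : past k setT.
  exists (fun=> setT) => //; apply/esym; rewrite -subTset.
  by move=> w _ i _.
transitivity (mrestr P mXB A) => //.
rewrite muleC -rE.
transitivity (mscale r P A) => //.
apply: (g_sigma_algebra_measure_unique (past k) (@past_measurable k)
  (fun=> setT)) sA => //.
- by rewrite bigcup_const.
- exact: past_setI.
- move=> _ [C mC ->]; rewrite /= /mrestr /mscale/= fineK ?fin_num_measure//.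
  (* Putting [B] at index [k] turns the intersection into one event on the first k + 1 variables. *)
  pose C' i := if i == k then B else C i.
  have mC' i : measurable (C' i) by rewrite /C'; case: ifP.
  have C'k : C' k = B by rewrite /C' eqxx.
  have C'lt i : (i < k)%N -> C' i = C i.
    by move=> ik; rewrite /C' ltn_eqF.
  have -> : \bigcap_(i in `I_k) X i @^-1` C i `&` X k @^-1` B =
            \bigcap_(i in `I_k.+1) X i @^-1` C' i.
    apply/seteqP; split=> w /=.
      move=> [Cw Bw] i /=; rewrite ltnS leq_eqVlt => /predU1P[->|ik].
        by rewrite C'k.
      by rewrite C'lt//; exact: Cw.
    move=> Cw; split; first by move=> i ik; rewrite -C'lt//; exact/Cw/ltnW.
    by rewrite -C'k; exact: (Cw k (ltnSn k)).
  rewrite X_indep// X_indep; [|exact: ltnW|by []].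
  rewrite big_ord_recr/= C'k muleC; congr (_ * _)%E.
  by apply: eq_bigr => i _; rewrite C'lt.
- by move=> i; rewrite /= /mrestr setTI (le_lt_trans (probability_le1 _ _)) ?ltry.
Qed.

Local Notation past_bounded k g := 
  (@bounded_mfun R _ (g_sigma_algebraType (past k)) g).

Lemma past_bounded_mfun k (g : T -> R) : past_bounded k g -> bounded_mfun g.
Proof.
move=> [mg bg]; split => // _ B mB.
have := mg measurableT B mB; apply: (smallest_sub _ (@past_measurable k)).
exact: sigma_algebra_measurable.
Qed.

Lemma past_bounded_X i k : (i < k)%N -> past_bounded k (X i).
Proof.
move=> ik; split; last by exists 1.
move=> _ B mB; rewrite setTI; apply: sub_sigma_algebra.
exists (fun j => if j == i then B else setT).
  by move=> j; case: ifP.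
apply/seteqP; split=> w /=.
  by move=> Bw j _ /=; case: eqP => [->|].
by move=> /(_ i ik); rewrite eqxx.
Qed.

Lemma bounded_X k : bounded_mfun (X k).
Proof. by split => //; exists 1. Qed.

Lemma mean_past_comp k (g : T -> R) (h : R -> R) : (k < n)%N ->
  past_bounded k g -> bounded_mfun (h \o X k) -> measurable_fun [set: R] h ->
  mean P (fun w => g w * h (X k w)) = mean P g * mean P (h \o X k).
Proof.
move=> kn bg bh mh; apply: (meanM_indep (h := h \o X k)) => //.
  exact: past_bounded_mfun bg.
move=> A B mA mB; rewrite (_ : (h \o X k) @^-1` B = X k @^-1` (h @^-1` B))//.
have [mg _] := bg.
have hB : measurable (h @^-1` B) by rewrite -[_ @^-1` _]setTI; exact: mh.
rewrite past_indep//.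
by have := mg measurableT A mA; rewrite setTI.
Qed.

Lemma mean_past_X k (g : T -> R) : (k < n)%N -> past_bounded k g ->
  mean P (fun w => g w * X k w) = 0.
Proof.
move=> kn bg; rewrite (@mean_past_comp k g id)//; last exact: bounded_X.
by rewrite (_ : id \o X k = X k)// X_mean// mulr0.
Qed.

Lemma mean_past_sqr k (g : T -> R) : (k < n)%N -> past_bounded k g ->
  mean P (fun w => g w * X k w ^+ 2) =
  mean P g * mean P (fun w => X k w ^+ 2).
Proof.
move=> kn bg; rewrite (@mean_past_comp k g (fun y => y ^+ 2))//.
by apply: bounded_mfunX; exact: bounded_X.
Qed.

Section Quadratic.
Variables (I : finType) (B : nat -> I -> R) (th : R).
Hypothesis th_ge0 : 0 <= th.

Lemma past_bounded_arg k j (c : T -> I -> R) : (j < k)%N ->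
  (forall i, past_bounded k (fun w => c w i)) ->
  past_bounded k (fun w => infconv_arg B th (c w) j (X j w)).
Proof.
move=> jk bc; apply: bounded_mfunM; last exact: bounded_mfun_cst.
apply: bounded_mfunB; first exact: past_bounded_X.
apply: bounded_mfunM; first exact: bounded_mfun_cst.
by apply: bounded_mfun_sum => i; apply: bounded_mfunM => //;
  exact: bounded_mfun_cst.
Qed.

Lemma past_bounded_center k j i : (j <= k)%N ->
  past_bounded k (fun w => infconv_center B th j (X ^~ w) i).
Proof.
elim: j i => [|j IHj] i jk /=; first exact: bounded_mfun_cst.
apply: bounded_mfunD; first by apply: IHj; exact: ltnW.
apply: bounded_mfunM; last exact: bounded_mfun_cst.
by apply: past_bounded_arg => // i'; apply: IHj; exact: ltnW.
Qed.

Lemma past_bounded_potential k :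
  past_bounded k (fun w => potential B th k (X ^~ w)).
Proof.
apply: bounded_mfunD.
  apply: bounded_mfunM; first exact: bounded_mfun_cst.
  by apply: bounded_mfun_sum => i; apply: bounded_mfunX;
    exact: past_bounded_center.
apply: bounded_mfun_sum => j; apply: bounded_mfunM; last exact: bounded_mfun_cst.
apply: bounded_mfunX; apply: bounded_mfunB; first exact: past_bounded_X.
apply: past_bounded_arg => // i.
by apply: past_bounded_center; exact: ltnW.
Qed.

Lemma past_bounded_slope k :
  past_bounded k (fun w => potential_slope B th k (X ^~ w)).
Proof.
apply: bounded_mfunM; last exact: bounded_mfun_cst.
apply: bounded_mfunM; first exact: bounded_mfun_cst.
apply: bounded_mfun_sum => i; apply: bounded_mfunM; last exact: bounded_mfun_cst.
exact: past_bounded_center.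
Qed.

(** The supermartingale step, without conditional expectations: the increment is majorized by a
    quadratic polynomial in [X k] whose coefficients depend on the past, so its mean factors term by
    term. The weight [e] varies with the past through the slope. *)
Lemma mean_expR_potentialS k : (k < n)%N ->
  mean P (fun w => expR (potential B th k.+1 (X ^~ w))) <=
  mean P (fun w => expR (potential B th k (X ^~ w))) *
  expR (th * (\sum_i B k i ^+ 2) * mean P (fun w => X k w ^+ 2)).
Proof.
move=> kn; set v := mean P (fun w => X k w ^+ 2); set sq := \sum_i B k i ^+ 2.
have sq0 : 0 <= sq by apply: sumr_ge0 => i _; exact: sqr_ge0.
have v0 : 0 <= v by apply: mean_ge0 => w; exact: sqr_ge0.
have thsq0 : 0 <= th * sq by rewrite mulr_ge0.
pose D := 1 + 4 * (th * sq).
have D1 : 1 <= D by rewrite /D; lra.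
pose s := th * sq / D; pose A := th * sq * v.
pose b w := potential_slope B th k (X ^~ w).
pose e w := expR (b w ^+ 2 - A).
pose G w := expR (potential B th k (X ^~ w) - D * b w ^+ 2).
have s0 : 0 <= s by rewrite divr_ge0//; lra.
have bb : past_bounded k b by exact: past_bounded_slope.
have be : past_bounded k e.
  apply: bounded_mfun_expR; apply: bounded_mfunB; last exact: bounded_mfun_cst.
  exact: bounded_mfunX.
have bei : past_bounded k (fun w => (e w)^-1).
  under eq_fun do rewrite /e -expRN.
  apply: bounded_mfun_expR; apply: bounded_mfunN; apply: bounded_mfunB.
    exact: bounded_mfunX.
  exact: bounded_mfun_cst.
have b2 : past_bounded k (fun w => expR (2 * b w)).
  by apply: bounded_mfun_expR; apply: bounded_mfunM => //;
    exact: bounded_mfun_cst.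
have b2N : past_bounded k (fun w => expR (- (2 * b w))).
  apply: bounded_mfun_expR; apply: bounded_mfunN; apply: bounded_mfunM => //.
  exact: bounded_mfun_cst.
have bG : past_bounded k G.
  apply: bounded_mfun_expR; apply: bounded_mfunB.
    exact: past_bounded_potential.
  apply: bounded_mfunM; first exact: bounded_mfun_cst.
  exact: bounded_mfunX.
have bm0 : past_bounded k (fun w => G w * maj0 (e w) (b w)).
  apply: bounded_mfunM => //; apply: bounded_mfunM; last exact: bounded_mfun_cst.
  apply: bounded_mfunD => //; apply: bounded_mfunM => //.
  apply: bounded_mfunM; last exact: bounded_mfun_cst.
  exact: bounded_mfunD.
have bm1 : past_bounded k (fun w => G w * maj1 (e w) (b w)).
  apply: bounded_mfunM => //; apply: bounded_mfunM; last exact: bounded_mfun_cst.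
  apply: bounded_mfunM => //.
  apply: bounded_mfunM; last exact: bounded_mfun_cst.
  exact: bounded_mfunB.
have bm2 : past_bounded k (fun w => G w * maj2 (e w) s).
  apply: bounded_mfunM => //; apply: bounded_mfunM; last exact: bounded_mfun_cst.
  by apply: bounded_mfunM => //; exact: bounded_mfun_cst.
have pb (g : T -> R) : past_bounded k g -> bounded_mfun g by exact: past_bounded_mfun.
have bX := bounded_X k.
have bX2 : bounded_mfun (fun w => X k w ^+ 2) by exact: bounded_mfunX.
have bpot : bounded_mfun (fun w => potential B th k (X ^~ w)).
  by apply: (@past_bounded_mfun k); exact: past_bounded_potential.
have step : mean P (fun w => expR (potential B th k.+1 (X ^~ w))) <=
    mean P (fun w => G w * maj0 (e w) (b w)
      + (G w * maj1 (e w) (b w) * X k w + G w * maj2 (e w) s * X k w ^+ 2)).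
  apply: le_mean.
  - apply: bounded_mfun_expR; apply: (@past_bounded_mfun k.+1).
    exact: past_bounded_potential.
  - apply: bounded_mfunD; first exact: pb.
    by apply: bounded_mfunD; apply: bounded_mfunM => //; exact: pb.
  - move=> w; rewrite potentialS// expRD -/sq -/D -/(b w) -/s -/(G w).
    have := @expR_quad_le_maj _ (e w) (b w) s (X k w) (expR_gt0 _) s0 (X_le1 k w).
    move/(ler_wpM2l (expR_ge0 _ : 0 <= G w))/le_trans; apply.
    by rewrite !mulrDr !mulrA addrA.
apply: (le_trans step).
rewrite meanD; [|exact: pb|]; last first.
  by apply: bounded_mfunD; apply: bounded_mfunM => //; exact: pb.
rewrite meanD; [|by apply: bounded_mfunM => //; exact: pb..].
(* The linear term vanishes because [X k] is centred, and the square contributes the factor [v]. *)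
rewrite mean_past_X// mean_past_sqr// add0r -/v mulrC -meanZ; last exact: pb.
rewrite -meanD; [|exact: pb|]; last first.
  by apply: bounded_mfunM; [exact: bounded_mfun_cst|exact: pb].
rewrite mulrC -meanZ; last exact: bounded_mfun_expR.
apply: le_mean.
- apply: bounded_mfunD; first exact: pb.
  by apply: bounded_mfunM; [exact: bounded_mfun_cst|exact: pb].
- by apply: bounded_mfunM; [exact: bounded_mfun_cst|exact: bounded_mfun_expR].
move=> w; rewrite (mulrCA v) -mulrDr -expRD.
have vA : v * (expR (2 * s) - 1) <= 2 * A.
  have := ler_wpM2l v0 (expR_double_le thsq0); rewrite -/D -/s /A; lra.
have := maj_moment_le (b w) vA; rewrite -/(e w) [X in _ + X]mulrC => h.
apply: le_trans (ler_wpM2l (expR_ge0 _) h) _.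
(* The moment bound leaves b^2 in the exponent, and [G] carries - D b^2 with D >= 1. *)
rewrite -expRD ler_expR /A; have := sqr_ge0 (b w); nra.
Qed.

Definition quad_form k w : R := \sum_i (\sum_(j < k) X j w * B j i) ^+ 2.

Lemma past_bounded_partial k i :
  past_bounded k (fun w => \sum_(j < k) X j w * B j i).
Proof.
apply: bounded_mfun_sum => j; apply: bounded_mfunM; last exact: bounded_mfun_cst.
exact: past_bounded_X.
Qed.

Lemma past_bounded_quad_form k : past_bounded k (quad_form k).
Proof.
by apply: bounded_mfun_sum => i; apply: bounded_mfunX;
  exact: past_bounded_partial.
Qed.

Lemma bounded_quad_form k : bounded_mfun (quad_form k).
Proof. exact: past_bounded_mfun (past_bounded_quad_form k). Qed.

(** Adding variable [k] creates a cross term linear in [X k] with a coefficient from the past, so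
    its mean is zero. *)
Lemma mean_quad_form k : (k <= n)%N ->
  mean P (quad_form k) =
  \sum_(j < k) (\sum_i B j i ^+ 2) * mean P (fun w => X j w ^+ 2).
Proof.
elim: k => [|k IHk] kn.
  rewrite big_ord0 -[RHS](mean_cst P 0); apply: eq_mean => w.
  by rewrite /quad_form big1// => i _; rewrite big_ord0 expr0n.
rewrite big_ord_recr/= -IHk; last exact: ltnW.
pose c w := 2 * \sum_i (\sum_(j < k) X j w * B j i) * B k i.
have bc : past_bounded k c.
  apply: bounded_mfunM; first exact: bounded_mfun_cst.
  apply: bounded_mfun_sum => i; apply: bounded_mfunM; last exact: bounded_mfun_cst.
  exact: past_bounded_partial.
have bcX : bounded_mfun (fun w => c w * X k w).
  by apply: bounded_mfunM; [exact: past_bounded_mfun bc|exact: bounded_X].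
have bX2 : bounded_mfun (fun w => X k w ^+ 2).
  by apply: bounded_mfunX; exact: bounded_X.
rewrite -meanZ//.
transitivity (mean P (quad_form k) + mean P (fun w => c w * X k w) +
  mean P (fun w => (\sum_i B k i ^+ 2) * X k w ^+ 2)); last first.
  by rewrite mean_past_X// addr0.
have bq := bounded_quad_form k.
rewrite -!meanD//; last first.
- by apply: bounded_mfunM => //; exact: bounded_mfun_cst.
- by apply: bounded_mfunD.
apply: eq_mean => w; rewrite /quad_form /c mulr_sumr !mulr_suml -!big_split/=.
by apply: eq_bigr => i _; rewrite big_ord_recr/=; ring.
Qed.

(** [potential_ge] dominates the form pointwise; each variable then costs one factor exp (th |B_k|^2
    E X_k^2), and these multiply to the right-hand side. *)
Lemma mgf_quad_form :
  mean P (fun w => expR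
    (th / (1 + 4 * th * \sum_(j < n) \sum_i B j i ^+ 2) * quad_form n w)) <=
  expR (th * mean P (quad_form n)).
Proof.
have bpot k : bounded_mfun (fun w => expR (potential B th k (X ^~ w))).
  apply: bounded_mfun_expR; apply: (@past_bounded_mfun k).
  exact: past_bounded_potential.
apply: (@le_trans _ _ (mean P (fun w => expR (potential B th n (X ^~ w))))).
  apply: le_mean => //.
    apply: bounded_mfun_expR; apply: bounded_mfunM; first exact: bounded_mfun_cst.
    exact: bounded_quad_form.
  by move=> w; rewrite ler_expR; exact: potential_ge.
rewrite mean_quad_form// mulr_sumr.
suff : forall k, (k <= n)%N ->
    mean P (fun w => expR (potential B th k (X ^~ w))) <=
    expR (\sum_(j < k) th *
      ((\sum_i B j i ^+ 2) * mean P (fun w => X j w ^+ 2))) by exact.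
elim=> [|k IHk] kn.
  rewrite big_ord0 expR0 -[leRHS](mean_cst P 1) le_eqVlt; apply/orP; left.
  apply/eqP/eq_mean => w; rewrite /potential /infconv_cost big_ord0/=.
  by rewrite big1 ?mulr0 ?addr0 ?expR0// => i _; rewrite expr0n.
apply: (le_trans (mean_expR_potentialS kn)).
by rewrite big_ord_recr/= expRD mulrA ler_wpM2r ?expR_ge0// IHk// ltnW.
Qed.

End Quadratic.

Lemma quad_form_tail (I : finType) (B : nat -> I -> R) (om K t : R)
    (V : T -> R) : (forall w, V w = om * quad_form B n w) ->
  0 <= om -> 4 * om * (\sum_(j < n) \sum_i B j i ^+ 2) <= K -> 0 < K -> 0 < t ->
  (P [set w | (V w - mean P V > t)%R] <=
   (expR (- t ^+ 2 / (2 * K * (2 * mean P V + t))))%:E)%E.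
Proof.
move=> /funext VE om0 SK K0 t0; set m := mean P V; set S := \sum_(j < n) _ in SK *.
have S0 : 0 <= S.
  by do 2 apply: sumr_ge0 => ? _; exact: sqr_ge0.
have bV : bounded_mfun V.
  by rewrite VE; apply: bounded_mfunM; [exact: bounded_mfun_cst|exact: bounded_quad_form].
have m0 : 0 <= m.
  by apply: mean_ge0 => w; rewrite VE mulr_ge0// sumr_ge0// => i _; exact: sqr_ge0.
have mgf l : 0 <= l -> l * K < 1 ->
    mean P (fun w => expR (l * V w)) <= expR (l * m / (1 - l * K)).
  move=> l0 lK.
  have lS : l * (4 * om * S) <= l * K by rewrite ler_wpM2l.
  have d0 : 0 < 1 - l * (4 * om * S) by lra.
  (* Chosen so that th / (1 + 4 th S) = l om, which makes the exponent equal to l V. *)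
  pose th := l * om / (1 - l * (4 * om * S)).
  have th0 : 0 <= th by rewrite divr_ge0 ?mulr_ge0// ltW.
  have dE : 1 + 4 * th * S = (1 - l * (4 * om * S))^-1.
    by rewrite /th; field; rewrite gt_eqF.
  have := mgf_quad_form B th0; rewrite -/S dE invrK.
  have -> : th * (1 - l * (4 * om * S)) = l * om.
    by rewrite /th divfK// gt_eqF.
  under eq_fun do rewrite -mulrA.
  rewrite {1}VE => /le_trans; apply; rewrite ler_expR.
  have mE : m = om * mean P (quad_form B n).
    by rewrite /m VE meanZ//; exact: bounded_quad_form.
  rewrite /th mulrAC -(mulrA l om) -mE ler_wpM2l// ?mulr_ge0//.
  by rewrite lef_pV2 ?posrE//; lra.
have [mV _] := bV.
have mpre Y : measurable Y -> measurable (V @^-1` Y).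
  by move=> mY; rewrite -[_ @^-1` _]setTI; exact: mV.
pose VR : {mfun T >-> R} := HB.pack V (isMeasurableFun.Build _ _ _ _ V mV).
have tail l : 0 < l -> l * K < 1 ->
    (P [set w | (V w - m > t)%R] <=
     (expR (l * m / (1 - l * K) - l * (m + t)))%:E)%E.
  move=> l0 lK; apply: (@le_trans _ _ (P [set w | (VR w >= m + t)%R])).
    apply: le_measure; rewrite ?inE.
    - rewrite (_ : [set w | _] = V @^-1` `]m + t, +oo[%classic).
        exact: mpre.
      by apply/seteqP; split=> w /=; rewrite in_itv/= andbT; lra.
    - rewrite (_ : [set w | _] = V @^-1` `[m + t, +oo[%classic).
        exact: mpre.
      by apply/seteqP; split=> w /=; rewrite in_itv/= andbT.
    - by move=> w /=; lra.
  apply: le_trans (chernoff VR (m + t) l0) _.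
  rewrite /mmt_gen_fun (_ : expR \o l \o* VR = fun w => expR (l * V w)); last first.
    by apply/funext => w /=; rewrite mulrC.
  rewrite mean_EFin; last first.
    apply: bounded_mfun_expR; apply: bounded_mfunM => //; exact: bounded_mfun_cst.
  rewrite -EFinM lee_fin expRD ler_wpM2r ?expR_ge0//.
  exact: mgf (ltW l0) lK.
(* For m = 0 the general choice of l below would give l K = 1, outside the range of [tail]; l = 1 /
   (2 K) already gives the claim. *)
have [m_eq0|m_neq0] := eqVneq m 0.
  have l0 : 0 < (2 * K)^-1 by rewrite invr_gt0 mulr_gt0.
  have lK : (2 * K)^-1 * K = 2^-1 by field; rewrite gt_eqF.
  apply: le_trans (tail _ l0 _) _; first by rewrite lK; lra.
  rewrite m_eq0 lee_fin ler_expR mulr0 mul0r !add0r.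
  by rewrite le_eqVlt; apply/orP; left; apply/eqP; field; rewrite !gt_eqF.
have m_gt0 : 0 < m by rewrite lt_def m_neq0.
have d0 : 0 < 2 * m + t by lra.
(* With this l, 1 - l K = 2 m / (2 m + t), and the Chernoff exponent is exactly the one claimed. *)
have l0 : 0 < t / (K * (2 * m + t)) by rewrite divr_gt0// mulr_gt0.
have lK : t / (K * (2 * m + t)) * K = t / (2 * m + t).
  by field; rewrite !gt_eqF.
apply: le_trans (tail _ l0 _) _; first by rewrite lK ltr_pdivrMr// mul1r; lra.
rewrite lee_fin ler_expR lK le_eqVlt; apply/orP; left; apply/eqP.
by field; rewrite !gt_eqF//; lra.
Qed.

End IndependentBounded.

(** * Load variation of valley-filling runs *)

Section ValleyFilling.
Context {R : realType}.
Variables (T : nat) (L : deferrable_loads R) (t : nat) (qlo qhi : nat -> R).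
Variables (EA : R) (bt Pt : nat -> R).
Hypothesis tT : (1 <= t <= T)%N.

Lemma sum_planned_load p q :
  odlc_feasible T L t qlo qhi EA Pt p q ->
  \sum_(t <= tau < T.+1) planned_load L t bt p q tau =
  \sum_(1 <= n < (arrived L t).+1) Pt n + EA + \sum_(t <= tau < T.+1) bt tau.
Proof.
move=> [_ sp _ sq]; rewrite /planned_load !big_split/= sq exchange_big_nat/=.
by congr (_ + _ + _); apply: eq_big_nat => n; rewrite ltnS => /sp.
Qed.

(** All feasible plans have the same total. Since a flat plan of level C exists, an optimal plan has
    squared deviations from C summing to at most 0. Thus whichever solution the run selects is
    flat. *)
Lemma odlc_solution_flat p q p' q' tau :
  odlc_solution T L t qlo qhi EA bt Pt p q ->
  valley_filling T L t qlo qhi EA bt Pt p' q' -> (t <= tau <= T)%N ->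
  planned_load L t bt p q tau * (T - t).+1%:R =
  \sum_(1 <= n < (arrived L t).+1) Pt n + EA + \sum_(t <= tau < T.+1) bt tau.
Proof.
move=> [feas opt] [feas' [C flat]] tauT.
have sumC : \sum_(t <= tau < T.+1) C = (T - t).+1%:R * C.
  by rewrite sumr_const_nat mulr_natl subSn//; case/andP: tT.
have total : \sum_(t <= tau < T.+1) planned_load L t bt p q tau = (T - t).+1%:R * C.
  rewrite (sum_planned_load feas) -(sum_planned_load feas') -sumC.
  by apply: eq_big_nat => s; rewrite ltnS => /flat.
have cost : \sum_(t <= tau < T.+1) planned_load L t bt p q tau ^+ 2 <=
    (T - t).+1%:R * C ^+ 2.
  apply: le_trans (opt _ _ feas') _; rewrite /odlc_cost.
  rewrite mulr_natl -subSn; last by case/andP: tT.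
  rewrite -sumr_const_nat le_eqVlt; apply/orP; left; apply/eqP.
  by apply: eq_big_nat => s; rewrite ltnS => /flat ->.
have dev : \sum_(t <= tau < T.+1) (planned_load L t bt p q tau - C) ^+ 2 <= 0.
  rewrite (eq_bigr (fun s => planned_load L t bt p q s ^+ 2 +
    (- (2 * C)) * planned_load L t bt p q s + C ^+ 2)); last by move=> s _; ring.
  rewrite !big_split/= -mulr_sumr total sumr_const_nat -mulr_natl subSn; last first.
    by case/andP: tT.
  lra.
have : planned_load L t bt p q tau - C = 0.
  apply/eqP; rewrite -sqrf_eq0 eq_le sqr_ge0 andbT; apply: le_trans dev.
  rewrite (bigD1_seq tau) ?mem_index_iota ?ltnS ?iota_uniq//=.
  by rewrite lerDl sumr_ge0// => s _; exact: sqr_ge0.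
by move/subr0_eq => ->; rewrite -(sum_planned_load feas) total mulrC.
Qed.

End ValleyFilling.

(** * Recursion for the realized load along a run *)

Section Run.
Context {R : realType}.
Variables (T : nat) (L : deferrable_loads R) (qlo qhi : nat -> nat -> R).
Variables (EA : nat -> R) (bbar : nat -> R) (f : int -> R) (e : nat -> R).
Variables (lambda : R) (p Prem : nat -> nat -> R).

Let b_ := predicted_baseload bbar f e.

Hypothesis T_ge1 : (1 <= T)%N.
Hypothesis f_causal : causal f.
Hypothesis L_valid : valid_loads T L.
Hypothesis q_now : forall t, (1 <= t <= T)%N -> qlo t t = 0 /\ qhi t t = 0.
Hypothesis EAE : forall t, (1 <= t <= T)%N -> EA t = (T - t)%:R * lambda.
Hypothesis run : mpc_run T L qlo qhi EA b_ p Prem.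
Hypothesis valley : forall t, (1 <= t <= T)%N -> exists pt qt,
  valley_filling T L t (qlo t) (qhi t) (EA t) (b_ t) (Prem t) pt qt.

Let load := aggregate_load T L (baseload T bbar f e) p.

Lemma arrived_mono s t : (s <= t <= T)%N -> (arrived L s <= arrived L t)%N.
Proof.
case: L_valid => _ mono _; elim: t => [|t IHt].
  by rewrite leqn0 andbT => /eqP ->.
move=> /andP[]; rewrite leq_eqVlt => /predU1P[->//|st] tT.
by apply: leq_trans (mono _ tT); apply: IHt; rewrite -ltnS st ltnW.
Qed.

(** By causality, errors occurring after [t] do not affect the baseload at [t]. *)
Lemma baseload_now t : (1 <= t <= T)%N -> baseload T bbar f e t = b_ t t.
Proof.
move=> /andP[t1 tT]; rewrite /baseload /b_ /predicted_baseload; congr (_ + _).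
rewrite (big_cat_nat (n := t.+1))//= [X in _ + X]big_nat_cond.
rewrite [X in _ + X]big1 ?addr0//.
by move=> m /andP[/andP[tm _] _]; rewrite f_causal ?mulr0// subr_lt0 ltz_nat.
Qed.

Lemma aggregate_load_now t : (1 <= t <= T)%N ->
  load t = \sum_(1 <= n < (arrived L t).+1) p n t + b_ t t.
Proof.
move=> tT; rewrite /load /aggregate_load baseload_now// addrC; congr (_ + _).
have [_ _ p0 _] := run; have [t1 tT'] := andP tT.
rewrite (big_cat_nat (n := (arrived L t).+1))//=; last first.
  by rewrite ltnS arrived_mono// tT' leqnn.
rewrite [X in _ + X]big_nat_cond [X in _ + X]big1 ?addr0// => n.
by rewrite andbT ltnS => /p0 ->.
Qed.

(** The energy still to be served plus the predicted remaining baseload: the numerator of the closed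
    formula for the load. *)
Let total t := \sum_(1 <= n < (arrived L t).+1) Prem t n + EA t
               + \sum_(t <= tau < T.+1) b_ t tau.

Lemma aggregate_load_total t : (1 <= t <= T)%N ->
  load t * (T - t).+1%:R = total t.
Proof.
move=> tT; have [t1 tT'] := andP tT.
have [_ /(_ t tT) [pt [qt [sol ptE]]] _ _] := run.
have [p' [q' vf]] := valley tT.
rewrite /total -(odlc_solution_flat tT sol vf (tau := t)) ?leqnn//.
congr (_ * _); rewrite aggregate_load_now// /planned_load.
have [qlo0 qhi0] := q_now tT.
(* Both pseudo-load bounds vanish at the current time, so the planned load there is the realized
   one. *)
have -> : qt t = 0.
  have [[_ _ /(_ t) + _] _] := sol; rewrite leqnn tT' => /(_ isT).
  by rewrite qlo0 qhi0 -eq_le => /eqP.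
by rewrite addr0; congr (_ + _); apply: eq_big_nat => n; rewrite ltnS => /ptE.
Qed.

(** The index [t.-1] includes the devices arriving at [t] itself: they have consumed nothing before
    [t]. *)
Lemma Prem_not_arrived n t : (1 <= t <= T)%N ->
  (arrived L t.-1 < n <= arrived L T)%N ->
  Prem t n = energy L n.
Proof.
have [P1 _ p0 PS] := run; elim: t => [//|t IHt] /andP[_ tT] nt.
have n1 : (1 <= n <= arrived L T)%N.
  by case/andP: nt => + ->; rewrite andbT; apply: leq_ltn_trans.
case: t IHt tT nt => [|t] IHt tT nt; first exact: P1.
have tT' : (1 <= t.+1 <= T)%N by exact: ltnW.
rewrite PS// IHt// ?p0 ?subr0//.
case/andP: nt => /= nt ->; rewrite andbT; apply: leq_ltn_trans nt.
by apply: arrived_mono; rewrite leqnSn ltnW.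
Qed.

Definition innovation t : R :=
  energy_request L t - lambda + e t * cumulative_response f (T - t).

(** From t to t + 1 the load served at t leaves the total, a(t+1) enters while its expectation
    lambda leaves [EA], and the newly observed error shifts the predictions by e(t+1) F(T-t-1). *)
Lemma totalS t : (1 <= t < T)%N ->
  total t.+1 = total t - load t + innovation t.+1.
Proof.
move=> /andP[t1 tT]; have tT1 : (1 <= t <= T)%N by rewrite t1 ltnW.
have [_ _ p0 PS] := run.
have NS : (arrived L t <= arrived L t.+1)%N by apply: arrived_mono; rewrite leqnSn.
have NT s : (s <= T)%N -> (arrived L s <= arrived L T)%N.
  by move=> sT; apply: arrived_mono; rewrite sT leqnn.
have energyE : \sum_(1 <= n < (arrived L t.+1).+1) Prem t.+1 n =
    \sum_(1 <= n < (arrived L t).+1) Prem t n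
    - \sum_(1 <= n < (arrived L t).+1) p n t + energy_request L t.+1.
  rewrite (big_cat_nat (n := (arrived L t).+1))//=; congr (_ + _).
    rewrite -sumrB; apply: eq_big_nat => n /andP[n1]; rewrite ltnS => nt.
    by rewrite PS// n1 (leq_trans nt)// NT// ltnW.
  apply: eq_big_nat => n /andP[tn nt]; apply: Prem_not_arrived => //=.
  by rewrite tn -ltnS (leq_trans nt)// ltnS NT.
have baseE : \sum_(t.+1 <= tau < T.+1) b_ t.+1 tau =
    \sum_(t <= tau < T.+1) b_ t tau - b_ t t
    + e t.+1 * cumulative_response f (T - t.+1).
  rewrite [X in X - _]big_ltn ?ltnS ?(ltnW tT)// [b_ t t + _]addrC addrK.
  have shift (G : nat -> R) : \sum_(t.+1 <= tau < T.+1) G tau =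
      \sum_(0 <= i < (T - t.+1).+1) G (i + t.+1)%N.
    by rewrite -{1}[t.+1]add0n big_addn subSn.
  rewrite !shift /cumulative_response mulr_sumr -big_split/=.
  apply: eq_bigr => i _; rewrite /b_ /predicted_baseload.
  by rewrite big_nat_recr//= addrA PoszD addrK.
rewrite /total energyE baseE aggregate_load_now// !EAE// ?t1//.
rewrite /innovation -[in (T - t)%N](subnSK tT) -natr1; ring.
Qed.

Lemma aggregate_loadS t : (1 <= t < T)%N ->
  load t.+1 = load t + innovation t.+1 / (T - t.+1).+1%:R.
Proof.
move=> tT; have [t1 tT'] := andP tT.
have tT1 : (1 <= t <= T)%N by rewrite t1 ltnW.
have h1 : load t * (T - t).+1%:R = total t by exact: aggregate_load_total.
have h2 : load t.+1 * (T - t.+1).+1%:R = total t.+1.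
  exact: aggregate_load_total.
move: h2; rewrite totalS// -h1 -(subnSK tT') => h2.
have n0 : (T - t.+1).+1%:R != 0 :> R by rewrite pnatr_eq0.
by apply: (mulIf n0); rewrite h2 [RHS]mulrDl divfK// -natr1; ring.
Qed.

(** Subtracting the first innovation from the constant lets the sum start at 1, so that all
    innovations are treated alike; constants do not affect the variation. *)
Lemma aggregate_loadE t : (1 <= t <= T)%N ->
  load t = load 1 - innovation 1 / T%:R
  + \sum_(1 <= tau < t.+1) innovation tau / (T - tau).+1%:R.
Proof.
elim: t => [//|t IHt] tT; case: t => [|t] in IHt tT *.
  by rewrite big_nat1 subn1 prednK// subrK.
rewrite aggregate_loadS ?(andP tT).2// IHt; last by case/andP: tT => _ /ltnW ->.
by rewrite [in RHS]big_nat_recr//= addrA.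
Qed.

End Run.

(** * The load variation as a quadratic form in the innovations *)

Section LoadVariation.
Context {R : realType} (T : nat).
Hypothesis T_ge1 : (1 <= T)%N.

(** The weight of the innovation at [tau] in the load at [t], minus its average over the horizon:
    the indicator of tau <= t has average (T - tau + 1) / T. *)
Definition centred_response (t tau : nat) : R :=
  ((tau <= t)%N%:R - (T - tau).+1%:R / T%:R) / (T - tau).+1%:R.

Let T0 : T%:R != 0 :> R. Proof. by rewrite pnatr_eq0 -lt0n. Qed.

Lemma sum_indicator_le tau : (1 <= tau <= T)%N ->
  \sum_(1 <= t < T.+1) (tau <= t)%N%:R = (T - tau).+1%:R :> R.
Proof.
move=> /andP[t1 tT]; rewrite (big_cat_nat (n := tau))//=; last exact: leqW.
rewrite big_nat_cond big1 ?add0r; last first.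
  by move=> i /andP[/andP[_ it] _]; rewrite leqNgt it.
rewrite (eq_big_nat _ _ (F2 := fun=> 1)); last by move=> i /andP[-> _].
by rewrite sumr_const_nat subSn.
Qed.

Lemma load_variationE (d u : nat -> R) (c : R) :
  (forall t, (1 <= t <= T)%N ->
     d t = c + \sum_(1 <= tau < t.+1) u tau / (T - tau).+1%:R) ->
  load_variation T d = T%:R^-1 * \sum_(1 <= t < T.+1)
    (\sum_(1 <= tau < T.+1) u tau * centred_response t tau) ^+ 2.
Proof.
move=> dE; rewrite /load_variation; congr (_ * _).
have dE' t : (1 <= t <= T)%N -> d t =
    c + \sum_(1 <= tau < T.+1) (u tau / (T - tau).+1%:R) * (tau <= t)%N%:R.
  move=> /andP[t1 tT]; rewrite dE ?t1//; congr (_ + _).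
  rewrite [RHS](big_cat_nat (n := t.+1))//= [X in _ + X]big_nat_cond.
  rewrite [X in _ + X]big1 ?addr0; last first.
    by move=> i /andP[/andP[ti _] _]; rewrite leqNgt ti mulr0.
  by apply: eq_big_nat => i /andP[_]; rewrite ltnS => ->; rewrite mulr1.
have sumE : \sum_(1 <= tau < T.+1) d tau = T%:R * c +
    \sum_(1 <= tau < T.+1) u tau.
  rewrite (eq_big_nat _ _ (F2 := fun t => c +
    \sum_(1 <= tau < T.+1) (u tau / (T - tau).+1%:R) * (tau <= t)%N%:R)); last first.
    by move=> t; rewrite ltnS; exact: dE'.
  rewrite big_split/= sumr_const_nat subSS subn0 mulr_natl; congr (_ + _).
  rewrite exchange_big_nat/=; apply: eq_big_nat => tau; rewrite ltnS => tauT.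
  by rewrite -mulr_sumr sum_indicator_le// divfK// pnatr_eq0.
apply: eq_big_nat => t; rewrite ltnS => tT; congr (_ ^+ 2).
rewrite dE'// sumE mulrDr mulKf// opprD addrACA subrr add0r mulr_sumr -sumrB.
apply: eq_bigr => tau _; rewrite /centred_response.
have : (T - tau).+1%:R != 0 :> R by rewrite pnatr_eq0.
by move: (T - tau).+1%:R => k k0; field; rewrite k0 T0.
Qed.

(** The variance of an indicator: with k = T - tau + 1 and q = k / T, the sum is T q (1 - q) /
    k^2. *)
Lemma sum_centred_response_sqr tau : (1 <= tau <= T)%N ->
  \sum_(1 <= t < T.+1) centred_response t tau ^+ 2 =
  (T - tau).+1%:R^-1 - T%:R^-1.
Proof.
move=> tauT; have n0 : (T - tau).+1%:R != 0 :> R by rewrite pnatr_eq0.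
rewrite (eq_bigr (fun t : nat => (T - tau).+1%:R^-2 *
    ((1 - 2 * ((T - tau).+1%:R / T%:R)) * (tau <= t)%N%:R
     + ((T - tau).+1%:R / T%:R) ^+ 2))); last first.
  move=> t _; rewrite /centred_response; case: (tau <= t)%N => /=;
    by move: n0; move: (T - tau).+1%:R => k k0; field; rewrite k0 T0.
rewrite -mulr_sumr big_split/= -mulr_sumr sum_indicator_le// sumr_const_nat.
rewrite subSS subn0 -mulr_natl; move: (T - tau).+1%:R n0 => k k0.
by field; rewrite k0 T0.
Qed.

End LoadVariation.

(** * Hilbert-Schmidt norm of the noise response *)

Section ColumnNorms.
Context {R : realType}.

(** Each new term satisfies 1 / (n + 1) <= ln (n + 1) - ln n, from ln (1 - y) <= - y at y = 1 / (n +
    1). *)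
Lemma harmonic_le_ln n : (1 <= n)%N ->
  \sum_(m < n) m.+1%:R^-1 <= 1 + ln n%:R :> R.
Proof.
elim: n => [//|[|n] IHn] _; first by rewrite big_ord1 ln1 invr1 addr0.
rewrite big_ord_recr/=; have {}IHn := IHn isT.
suff : n.+2%:R^-1 <= ln n.+2%:R - ln n.+1%:R :> R.
  by move=> /(lerD IHn)/le_trans; apply; rewrite addrA (addrAC 1) addrK.
have n1 : 0 < n.+1%:R :> R by rewrite ltr0n.
have n2 : 0 < n.+2%:R :> R by rewrite ltr0n.
rewrite -ln_div ?posrE// -[leRHS]opprK -lnV ?posrE ?divr_gt0// invf_div lerNr.
have -> : n.+1%:R / n.+2%:R = 1 + - n.+2%:R^-1 :> R.
  by rewrite -[in LHS](addrK 1 n.+1%:R) natr1 mulrBl divff ?mul1r// gt_eqF.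
by apply: le_ln1Dx; rewrite ltrN2 invf_lt1// ltr1n.
Qed.

Variables (T : nat) (f : int -> R).
Hypothesis T_ge1 : (1 <= T)%N.

(** The 2T noise variables are numbered from 0: first a(1), ..., a(T), then e(1), ..., e(T). The
    gain is the factor of the variable in its innovation. *)
Definition noise_gain (k : nat) : R :=
  if (k < T)%N then 1 else cumulative_response f (T - (k - T).+1).

Definition noise_time (k : nat) : nat := if (k < T)%N then k.+1 else (k - T).+1.

(** Column [k] of the matrix B; [eps] compensates for dividing the noise by it. *)
Definition noise_response (eps : R) (k : nat) (i : 'I_T) : R :=
  eps * noise_gain k * centred_response T i.+1 (noise_time k).

Lemma lambda1_ge0 : 0 <= lambda1 T f.
Proof. by rewrite /lambda1 le_max divr_ge0// ln_ge0// ler1n. Qed.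

(** The a-columns add up to the harmonic sum minus 1, at most ln T, and the e-columns to the
    weighted sum of F^2. Each is bounded by one argument of the maximum [lambda1], hence the factor
    2. *)
Lemma sum_noise_response_sqr eps :
  T%:R^-1 * (\sum_(k < T + T) \sum_i noise_response eps k i ^+ 2) <=
  2 * eps ^+ 2 * lambda1 T f.
Proof.
have T0 : 0 < T%:R :> R by rewrite ltr0n.
have colE k : (1 <= noise_time k <= T)%N ->
    \sum_i noise_response eps k i ^+ 2 = eps ^+ 2 * (noise_gain k ^+ 2 *
      ((T - noise_time k).+1%:R^-1 - T%:R^-1)).
  move=> kT; rewrite -(sum_centred_response_sqr T_ge1 kT) big_add1/= big_mkord.
  by rewrite !mulr_sumr; apply: eq_bigr => i _; rewrite /noise_response; ring.
have lo k : (k < T)%N -> \sum_i noise_response eps k i ^+ 2 =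
    eps ^+ 2 * ((T - k.+1).+1%:R^-1 - T%:R^-1).
  by move=> kT; rewrite colE /noise_gain /noise_time kT// expr1n mul1r//.
have hi k : (k < T)%N -> \sum_i noise_response eps (T + k) i ^+ 2 =
    eps ^+ 2 * (cumulative_response f (T - k.+1) ^+ 2 *
      ((T - k.+1).+1%:R^-1 - T%:R^-1)).
  have Tk : (T + k < T)%N = false by rewrite ltnNge leq_addr.
  by move=> kT; rewrite colE /noise_gain /noise_time Tk addKn.
rewrite big_split_ord/=.
under eq_bigr => k _ do rewrite lo//.
under [X in _ + X]eq_bigr => k _ do rewrite hi//.
(* Reversing time replaces T - tau by the summation index, as in [lambda1]. *)
rewrite (reindex_inj rev_ord_inj)/= [X in _ + X](reindex_inj rev_ord_inj)/=.
have revK (k : 'I_T) : (T - (T - k.+1).+1 = k)%N.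
  by rewrite subnSK// subKn// ltnW.
under eq_bigr => k _ do rewrite revK.
under [X in _ + X]eq_bigr => k _ do rewrite revK.
rewrite -!mulr_sumr -mulrDr mulrCA -mulrA [leRHS]mulrCA ler_wpM2l ?sqr_ge0//.
have part1 : T%:R^-1 * (\sum_(k < T) (k.+1%:R^-1 - T%:R^-1)) <= lambda1 T f.
  apply: (@le_trans _ _ (ln T%:R / T%:R)); last by rewrite /lambda1 le_max lexx.
  rewrite mulrC ler_wpM2r ?invr_ge0 ?ler0n// sumrB sumr_const card_ord.
  rewrite -(mulr_natl T%:R^-1) divff ?gt_eqF//.
  by have := harmonic_le_ln T_ge1; lra.
have part2 : T%:R^-1 * (\sum_(k < T) cumulative_response f k ^+ 2 *
    (k.+1%:R^-1 - T%:R^-1)) <= lambda1 T f.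
  rewrite /lambda1 le_max; apply/orP; right.
  rewrite big_mkord !mulr_sumr; apply: ler_sum => k _.
  rewrite !(mulrCA _ (_ ^+ 2)) ler_wpM2l ?sqr_ge0//.
  have k0 : 0 < k%:R + 1 :> R by rewrite natr1 ltr0n.
  rewrite -natr1 -subr_ge0.
  (* The column norms give the numerator T - k - 1 against T - k + 1 in [lambda1], hence the gap
     2. *)
  have -> : (T%:R ^+ 2)^-1 * ((T%:R - k%:R + 1) / (k%:R + 1)) -
      T%:R^-1 * ((k%:R + 1)^-1 - T%:R^-1) =
      2 / (T%:R ^+ 2 * (k%:R + 1)) :> R.
    by field; rewrite !gt_eqF.
  by rewrite divr_ge0// mulr_ge0// ?sqr_ge0// ltW.
by lra.
Qed.

End ColumnNorms.

(** * Clipped noise *)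

Section AlmostEverywhere.
Context {R : realType} d {T : measurableType d} (P : probability T R).

Lemma ae_witness (Q : T -> Prop) : {ae P, forall w, Q w} -> exists w, Q w.
Proof.
move=> [N [mN N0 QN]]; apply: contrapT => /forallNP nQ.
have : P N = 1%E.
  rewrite (_ : N = setT) ?probability_setT//.
  by rewrite -subTset => w _; apply: QN; exact: nQ.
by rewrite N0 => /eqP; rewrite eq_sym onee_eq0.
Qed.

Lemma le_measure_ae (A B : set T) : measurable A -> measurable B ->
  {ae P, forall w, A w -> B w} -> (P A <= P B)%E.
Proof.
move=> mA mB [N [mN N0 ABN]]; rewrite -(measureU0 mB mN N0).
apply: le_measure; rewrite ?inE//; first exact: measurableU.
move=> w Aw; have [Bw|nBw] := pselect (B w); first by left.
by right; apply: ABN => /= /(_ Aw).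
Qed.

Lemma eq_mean_ae (g h : T -> R) : measurable_fun [set: T] g ->
  measurable_fun [set: T] h -> {ae P, forall w, g w = h w} ->
  mean P g = mean P h.
Proof.
move=> mg mh gh; rewrite /mean unlock; congr fine; apply: ae_eq_integral => //.
- exact/measurable_EFinP.
- exact/measurable_EFinP.
- by apply: filterS gh => w /= ghw _; rewrite ghw.
Qed.

End AlmostEverywhere.

Section Clipping.
Context {R : realType}.

(** Truncation to [-c, c] turns an almost sure bound into one valid everywhere, as the tail bound
    requires, while changing the variable only on a null set. *)
Definition clip (c y : R) : R := Num.max (- c) (Num.min c y).

Lemma clip_id c y : `|y| <= c -> clip c y = y.
Proof.
by rewrite ler_norml /clip => /andP[cy yc]; rewrite (min_idPr yc) (max_idPr cy).
Qed.

Lemma norm_clip_le c y : 0 <= c -> `|clip c y| <= c.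
Proof.
move=> c0; rewrite ler_norml /clip le_max lexx/= ge_max ge_min lexx andbT.
lra.
Qed.

Lemma measurable_clip c : measurable_fun [set: R] (clip c).
Proof. by apply: measurable_maxr => //; apply: measurable_minr. Qed.

End Clipping.

(** * Independence of the concatenated noise *)

Section InitialSegments.
Context {R : realType} d {Omega : measurableType d} (P : probability Omega R).
Variable T : nat.

Lemma prefix_indep (Y : nat -> {RV P >-> R}) k (B : nat -> set R) :
  independent_RVs (horizon T) Y -> (k <= T)%N -> (forall i, measurable (B i)) ->
  P (\bigcap_(i in `I_k) (Y i.+1 @^-1` B i)) =
  (\prod_(i < k) P (Y i.+1 @^-1` B i))%E.
Proof.
move=> indep kT mB.
have := indep (iota 1 k) (fun i => B i.-1) (iota_uniq _ _) _ _.
have -> : \bigcap_(i in [set` iota 1 k]) (Y i @^-1` B i.-1) =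
          \bigcap_(i in `I_k) (Y i.+1 @^-1` B i).
  apply/seteqP; split=> w /= Yw i.
    by move=> /= ik; apply: (Yw i.+1); rewrite /= mem_iota/= add1n ltnS.
  rewrite /= mem_iota add1n ltnS => /andP[i0 ik].
  by case: i i0 ik => // i _ ik; exact: Yw.
move=> ->//.
- rewrite (iotaDl 1 0 k) big_map (_ : iota 0 k = index_iota 0 k).
    by rewrite big_mkord.
  by rewrite /index_iota subn0.
- move=> i; rewrite /horizon/= mem_iota add1n ltnS => /andP[-> ik].
  exact: leq_trans kT.
Qed.

Lemma prefix_sigma (Y : nat -> {RV P >-> R}) k (B : nat -> set R) :
  (k <= T)%N -> (forall i, measurable (B i)) ->
  sigma_RVs (horizon T) Y (\bigcap_(i in `I_k) (Y i.+1 @^-1` B i)).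
Proof.
move=> kT mB; rewrite /sigma_RVs.
set G := (X in <<s X >>).
apply: (@bigcap_measurableType _ (g_sigma_algebraType G)) => i /= ik.
apply: sub_sigma_algebra; exists i.+1; last by exists (B i).
by rewrite /horizon /= (leq_trans ik).
Qed.

Variables (a e : nat -> {RV P >-> R}).

Definition noise (k : nat) : {RV P >-> R} :=
  if (k < T)%N then a k.+1 else e (k - T).+1.

(** An initial segment reaching past the a-block splits into an event on all of [a] and one on a
    prefix of [e]; independence of the families separates them, and the product rule applies to
    each. *)
Lemma noise_indep k (B : nat -> set R) :
  independent_RVs (horizon T) a -> independent_RVs (horizon T) e ->
  independent_families (horizon T) a e ->
  (k <= T + T)%N -> (forall i, measurable (B i)) ->
  P (\bigcap_(i in `I_k) (noise i @^-1` B i)) =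
  (\prod_(i < k) P (noise i @^-1` B i))%E.
Proof.
move=> a_indep e_indep ae_indep kTT mB.
have lo i : (i < T)%N -> noise i = a i.+1 by rewrite /noise => ->.
have hi i : noise (T + i) = e i.+1.
  by rewrite /noise ltnNge leq_addr/= addKn.
have [kT|Tk] := leqP k T.
  transitivity (P (\bigcap_(i in `I_k) (a i.+1 @^-1` B i))).
    congr (P _); apply: eq_bigcapr => i /= ik; rewrite lo//.
    exact: leq_trans kT.
  rewrite prefix_indep//; apply: eq_bigr => i _; rewrite lo//.
  exact: leq_trans kT.
pose m := (k - T)%N; have kE : k = (T + m)%N by rewrite /m subnKC// ltnW.
have mT : (m <= T)%N by rewrite /m leq_subLR.
have -> : \bigcap_(i in `I_k) (noise i @^-1` B i) =
    \bigcap_(i in `I_T) (a i.+1 @^-1` B i) `&`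
    \bigcap_(i in `I_m) (e i.+1 @^-1` B (T + i)%N).
  apply/seteqP; split=> w /=.
    move=> Zw; split=> i /= iT.
      by have := Zw i (ltn_trans iT Tk); rewrite lo.
    by have := Zw (T + i)%N; rewrite /= hi; apply; rewrite kE ltn_add2l.
  move=> [aw ew] i /=; have [iT _|Ti] := ltnP i T; first by rewrite lo//; exact: aw.
  rewrite -(subnKC Ti) hi kE ltn_add2l => im; exact: ew.
rewrite ae_indep; [|exact: prefix_sigma|].
- rewrite prefix_indep// (prefix_indep (B := fun i => B (T + i)%N))//.
  rewrite kE big_split_ord/=; congr (_ * _)%E.
    by apply: eq_bigr => i _; rewrite lo.
  by apply: eq_bigr => i _; rewrite hi.
- exact: (prefix_sigma (B := fun i => B (T + i)%N)).
Qed.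

End InitialSegments.

Theorem theorem1
    (R : realType) (dOmega : measure_display) (Omega : measurableType dOmega)
    (P : probability Omega R) (T : nat) (T_ge1 : (1 <= T)%N)
    (* baseload *)
    (bbar : nat -> R) (f : int -> R) (f_causal : causal f)
    (sigma : R) (e : nat -> {RV P >-> R})
    (e_mean : forall t, (1 <= t <= T)%N -> 'E_P[e t]%E = 0%E)
    (e_var : forall t, (1 <= t <= T)%N -> 'V_P[e t]%E = (sigma ^+ 2)%:E)
    (e_indep : independent_RVs (horizon T) e)
    (* deferrable loads *)
    (L : Omega -> deferrable_loads R)
    (L_valid : forall w, valid_loads T (L w))
    (lambda s : R) (a : nat -> {RV P >-> R})
    (a_def : forall t w, (1 <= t <= T)%N -> a t w = energy_request (L w) t)
    (a_mean : forall t, (1 <= t <= T)%N -> 'E_P[a t]%E = lambda%:E)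
    (a_var : forall t, (1 <= t <= T)%N -> 'V_P[a t]%E = (s ^+ 2)%:E)
    (a_indep : independent_RVs (horizon T) a)
    (ae_indep : independent_families (horizon T) a e)
    (* Algorithm 1 *)
    (qlo qhi : Omega -> nat -> nat -> R)
    (q_now : forall w t, (1 <= t <= T)%N -> qlo w t t = 0 /\ qhi w t t = 0)
    (EA : nat -> R)
    (EA_def : forall t, (1 <= t <= T)%N ->
       EA t = fine ('E_P[fun w => (\sum_(t.+1 <= tau < T.+1) a tau w)%R])%E)
    (p Prem : Omega -> nat -> nat -> R)
    (run : forall w,
       mpc_run T (L w) (qlo w) (qhi w) EA
         (predicted_baseload bbar f (fun m => e m w)) (p w) (Prem w))
    (* assumptions of the theorem *)
    (valley : forall w t, (1 <= t <= T)%N ->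
       exists pt qt,
         valley_filling T (L w) t (qlo w t) (qhi w t) (EA t)
           (predicted_baseload bbar f (fun m => e m w) t) (Prem w t) pt qt)
    (eps1 eps2 : R)
    (a_bounded : forall t, (1 <= t <= T)%N ->
       {ae P, forall w, `|a t w - lambda| <= eps1})
    (e_bounded : forall t, (1 <= t <= T)%N ->
       {ae P, forall w, `|e t w| <= eps2})
    (t : R) (t_gt0 : 0 < t) :
  let V := fun w => load_variation T
    (aggregate_load T (L w) (baseload T bbar f (fun m => e m w)) (p w)) in
  let EV := fine 'E_P[V]%E in
  let eps := Num.max eps1 eps2 in
  (P [set w | (V w - EV > t)%R] <=
   (expR (- t ^+ 2 / (16 * eps ^+ 2 * lambda1 T f * (2 * EV + t))))%:E)%E.
Proof.
cbv zeta; set V := (fun w => load_variation T _).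
set EV := fine _; set eps := Num.max _ _.
have eps1_le : eps1 <= eps by rewrite le_max lexx.
have eps2_le : eps2 <= eps by rewrite le_max lexx orbT.
pose mu (k : nat) : R := if (k < T)%N then lambda else 0.
pose Z k : {RV P >-> R} := noise T a e k.
have Zlo k : (k < T)%N -> Z k = a k.+1 by move=> kT; rewrite /Z /noise kT.
have Zhi k : Z (T + k)%N = e k.+1.
  by rewrite /Z /noise ltnNge leq_addr/= addKn.
have mulo k : (k < T)%N -> mu k = lambda by rewrite /mu => ->.
have muhi k : mu (T + k)%N = 0 by rewrite /mu ltnNge leq_addr.
have split_index (Q : nat -> Prop) : (forall k, (k < T)%N -> Q k) ->
    (forall k, (k < T)%N -> Q (T + k)%N) -> forall k, (k < T + T)%N -> Q k.
  move=> Qlo Qhi k kTT; have [/Qlo//|Tk] := ltnP k T.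
  by rewrite -(subnKC Tk); apply: Qhi; rewrite ltn_subLR.
have Z_bounded : {ae P, forall w, forall k, (k < T + T)%N -> `|Z k w - mu k| <= eps}.
  apply: ae_foralln => k; have [kTT|kTT] := ltnP k (T + T)%N; last first.
    by apply: aeW => w.
  suff : {ae P, forall w, `|Z k w - mu k| <= eps} by apply: filterS => w + _.
  move: k kTT; apply: split_index => k kT.
    rewrite Zlo// mulo//; have := a_bounded k.+1 kT.
    by apply: filterS => w /le_trans; apply.
  rewrite Zhi muhi; have := e_bounded k.+1 kT.
  by apply: filterS => w; rewrite subr0 => /le_trans; apply.
(* The sign of [eps] comes from a sample point satisfying the almost sure bound at index 0. *)
have eps0 : 0 <= eps.
  have [w /(_ 0%N)] := ae_witness Z_bounded; rewrite ltn_addr// => /(_ isT).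
  exact: le_trans.
pose Y k w := clip eps (Z k w - mu k).
have YE : {ae P, forall w, forall k, (k < T + T)%N -> Z k w - mu k = Y k w}.
  by apply: filterS Z_bounded => w Zb k /Zb h; rewrite /Y clip_id.
have mZ k : measurable_fun [set: Omega] (Z k) by exact: measurable_funPT.
have bY k : bounded_mfun (Y k).
  split; last by exists eps => w; exact: norm_clip_le.
  apply: measurableT_comp; first exact: measurable_clip.
  by apply: measurable_funB => //; exact: measurable_cst.
have mY k : measurable_fun [set: Omega] (Y k) by have [] := bY k.
have Y_mean k : (k < T + T)%N -> mean P (Y k) = 0.
  move=> kTT; have : mean P (Z k) = mu k.
    move: k kTT; apply: split_index => k kT; rewrite /mean.
      by rewrite Zlo// mulo// a_mean.
    by rewrite Zhi muhi e_mean.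
  rewrite (@eq_mean_ae _ _ _ _ _ (fun w => Y k w + mu k))//; last first.
  - by apply: filterS YE => w /(_ k kTT) <-; rewrite subrK.
  - by apply: measurable_funD => //; exact: measurable_cst.
  rewrite meanD//; last exact: bounded_mfun_cst.
  by rewrite mean_cst; lra.
have EAE u : (1 <= u <= T)%N -> EA u = (T - u)%:R * lambda.
  (* The request is replaced by its bounded version, to which additivity of [mean] applies. *)
  move=> uT; rewrite EA_def// -/(mean P _).
  rewrite (@eq_mean_ae _ _ _ _ _
    (fun w => \sum_(u.+1 <= tau < T.+1) (Y tau.-1 w + lambda))); first last.
  - apply: filterS YE => w YEw; apply: eq_big_nat => -[//|tau] /andP[_ tauT].
    by rewrite /= -YEw ?ltn_addr// Zlo// mulo// subrK.
  - apply: measurable_sum => tau; apply: measurable_funD; first exact: mY.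
    exact: measurable_cst.
  - by apply: measurable_sum => tau; exact: measurable_funPT.
  have bl : bounded_mfun (fun _ : Omega => lambda) by exact: bounded_mfun_cst.
  rewrite mean_sum; last by move=> tau; exact: bounded_mfunD.
  rewrite (eq_big_nat _ _ (F2 := fun=> lambda)).
    by rewrite sumr_const_nat subSS mulr_natl.
  move=> [//|tau] /andP[_ tauT]; rewrite meanD// mean_cst Y_mean ?add0r//.
  exact: ltn_addr.
(* The variation as a function of the centred noise, to be evaluated at both the original and the
   clipped variables. *)
pose Q (z : nat -> R) := T%:R^-1 * \sum_(i < T)
  (\sum_(k < T + T) z k *
    (noise_gain T f k * centred_response T i.+1 (noise_time T k))) ^+ 2.
have VE w : V w = Q (fun k => Z k w - mu k).
  rewrite /V (load_variationE T_ge1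
    (aggregate_loadE T_ge1 f_causal (L_valid w) (q_now w) EAE (run w) (valley w))).
  rewrite /Q big_add1/= big_mkord; congr (_ * _); apply: eq_bigr => i _.
  congr (_ ^+ 2); rewrite big_add1/= big_mkord big_split_ord/= -big_split/=.
  apply: eq_bigr => k _; rewrite Zhi muhi Zlo// mulo//.
  have Tk : (T + k < T)%N = false by rewrite ltnNge leq_addr.
  rewrite /noise_gain /noise_time Tk ltn_ord addKn /innovation -a_def//; first ring.
  by rewrite ltn_ord.
have mQ (z : nat -> Omega -> R) : (forall k, measurable_fun [set: Omega] (z k)) ->
    measurable_fun [set: Omega] (fun w => Q (z ^~ w)).
  move=> mz; apply: measurable_funM; first exact: measurable_cst.
  apply: measurable_sum => i; apply: measurable_funX.
  apply: measurable_sum => k; apply: measurable_funM; first exact: mz.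
  exact: measurable_cst.
have mV : measurable_fun [set: Omega] V.
  rewrite (funext VE); apply: (mQ (fun k w => Z k w - mu k)) => k.
  by apply: measurable_funB => //; exact: measurable_cst.
pose V' w := Q (Y ^~ w).
have mV' : measurable_fun [set: Omega] V' by exact: mQ.
have VV' : {ae P, forall w, V w = V' w}.
  apply: filterS YE => w YEw; rewrite VE /V' /Q; congr (_ * _).
  apply: eq_bigr => i _; congr (_ ^+ 2); apply: eq_bigr => k _.
  by rewrite YEw.
have EVE : EV = mean P V' by rewrite /EV -/(mean P V); exact: eq_mean_ae.
have mtail (g : Omega -> R) (r : R) : measurable_fun [set: Omega] g ->
    measurable [set w | g w - r > t].
  move=> mg; rewrite (_ : [set w | _] = g @^-1` `]t + r, +oo[%classic).
    by rewrite -[_ @^-1` _]setTI; exact: mg.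
  by apply/seteqP; split=> w /=; rewrite in_itv/= andbT ltrBrDr.
(* In the degenerate case the quotient has denominator 0 and so equals 0 by convention; the bound is
   then exp 0 = 1. *)
have [K_eq0|K_neq0] := eqVneq (eps ^+ 2 * lambda1 T f) 0.
  rewrite -(mulrA 16) K_eq0 mulr0 mul0r invr0 mulr0 expR0.
  by apply: probability_le1; exact: mtail.
have eps_neq0 : eps != 0.
  by apply: contra_neq K_neq0 => ->; rewrite expr0n mul0r.
have l0 := lambda1_ge0 f T_ge1.
have K_gt0 : 0 < eps ^+ 2 * lambda1 T f.
  by rewrite lt_def K_neq0 mulr_ge0// sqr_ge0.
apply: (@le_trans _ _ (P [set w | (V' w - mean P V' > t)%R])).
  apply: le_measure_ae; [exact: mtail..|].
  by apply: filterS VV' => w /= ->; rewrite EVE.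
(* Here 16 eps^2 lambda1 = 2 K, with K = 4 times the bound 2 eps^2 lambda1 on the normalized squared
   norm. *)
rewrite EVE (_ : 16 * eps ^+ 2 * lambda1 T f =
  2 * (8 * (eps ^+ 2 * lambda1 T f))); last by ring.
pose X k w := eps^-1 * Y k w.
apply: (@quad_form_tail _ _ _ P (T + T) X _ _ _ _ _ (noise_response f eps) T%:R^-1).
- by move=> k; apply: measurable_funM => //; exact: measurable_cst.
- move=> k w; rewrite normrM ger0_norm ?invr_ge0//.
  by rewrite mulrC ler_pdivrMr ?mul1r ?norm_clip_le// lt_def eps_neq0.
- by move=> k kTT; rewrite meanZ// Y_mean// mulr0.
- move=> k B kTT mB.
  (* Each [X i] is a measurable function of the noise variable [i] alone, so independence transfers
     through preimages. *)
  pose g i (y : R) := eps^-1 * clip eps (y - mu i).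
  have mg i : measurable_fun [set: R] (g i).
    apply: measurable_funM; first exact: measurable_cst.
    apply: measurableT_comp; first exact: measurable_clip.
    by apply: measurable_funB => //; exact: measurable_cst.
  apply: (@noise_indep _ _ _ P T a e k (fun i => g i @^-1` B i)) => // i.
  by rewrite -[_ @^-1` _]setTI; exact: mg.
- move=> w; rewrite /V' /Q /quad_form; congr (_ * _); apply: eq_bigr => i _.
  congr (_ ^+ 2); apply: eq_bigr => k _; rewrite /X /noise_response.
  by field.
- by rewrite invr_ge0 ler0n.
- have := sum_noise_response_sqr f T_ge1 eps; lra.
- by rewrite mulr_gt0.
- exact: t_gt0.
Qed.
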